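(* Let $P$ and $Q$ be finite posets, let $\mathcal{C}$ be a small abelian closed symmetric monoidal category with enough injectives, let $f : P \rightleftarrows Q : g$ be a Galois connection, and let $N \in \mathcal{C}^Q$, with dimension function $n : Q\to\mathcal{R}(\mathcal{C})$, $n(x)=[N(x)]$. Then, for every $a \in P$, \[ (\partial_P \circ f^\#)(n)(a) = \chi(\mathbf{1}_a, f^* N) = \chi(g^* \mathbf{1}_a, N) = (g_\# \circ \partial_Q)(n)(a) \] in $\mathcal{R}(\mathcal{C})$.
   Context: Let $(\mathcal{C},\otimes,\mathbf{1})$ be the monoidal category, with internal hom $\mathcal{H}om_{\mathcal{C}}(A,-)$ right adjoint to $-\otimes A$. A finite poset $P$ is viewed as a category with one morphism $a\to b$ whenever $a\le b$. A $P$-module is a functor $P\to\mathcal{C}$; $\mathcal{C}^P$ is the (abelian) category of $P$-modules and natural transformations; it has enough injectives when $\mathcal{C}$ does. For $M,M'\in\mathcal{C}^P$, $\underline{\mathrm{Hom}}(M,M') := \int_{a\in P}\mathcal{H}om_{\mathcal{C}}(M(a),M'(a))$ (an end). The functor $\underline{\mathrm{Hom}}(M,-):\mathcal{C}^P\to\mathcal{C}$ is left exact, and $\underline{\mathrm{Ext}}^d(M,-)$ is its $d$-th right derived functor. The same applies to $Q$. For $a\in P$, $\mathbf{1}_a$ is the $P$-module with $\mathbf{1}_a(a)=\mathbf{1}$ (the monoidal unit) and $\mathbf{1}_a(b)=0$ for $b\ne a$. A Galois connection $f:P\rightleftarrows Q:g$ consists of monotone functions $f:P\to Q$, $g:Q\to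 P$ such that $f(a)\le x\iff a\le g(x)$ for all $a\in P$, $x\in Q$. Pullbacks of modules: $f^*N=N\circ f\in\mathcal{C}^P$ and $g^*\mathbf{1}_a=\mathbf{1}_a\circ g\in\mathcal{C}^Q$. $\mathcal{R}(\mathcal{C})$ is the Grothendieck ring of $\mathcal{C}$, generated as an abelian group by isomorphism classes $[A]$ of objects subject to $[B]=[A]+[C]$ for each short exact sequence $0\to A\to B\to C\to0$; only this abelian group structure is used here. The Euler characteristic is $\chi(M,N):=\sum_{d\ge0}(-1)^d[\underline{\mathrm{Ext}}^d(M,N)]$ (here the Ext objects vanish for large $d$). For a function $m$ from $P$ to $\mathcal{R}(\mathcal{C})$, the (upper) Möbius inversion is $\partial_P m(a):=\sum_{b:a\le b}\mu_P[a,b]\,m(b)$, where the Möbius function $\mu_P$ is the integer-valued function on intervals $[a,b]$ ($a\le b$) that is inverse to $\zeta[a,b]=1$ under the convolution $(\alpha\ast\beta)[a,c]=\sum_{a\le b\le c}\alpha[a,b]\beta[b,c]$; likewise $\partial_Q$. For $n:Q\to\mathcal{R}(\mathcal{C})$, $f^\# n:P\to\mathcal{R}(\mathcal{C})$ is $f^\# n(a):=n(f(a))$, and for $m:Q\to\mathcal{R}(\mathcal{C})$, $g_\# m:P\to\mathcal{R}(\mathcal{C})$ is $g_\# m(a):=\sum_{x\in g^{-1}(a)}m(x)$. *)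

(* Defs.v *)
From HB Require Import structures.
From mathcomp Require Import all_boot all_order all_algebra.
From mathcomp Require Import boolp classical_sets fsbigop.
From mathcomp Require Import freeg.

Set Implicit Arguments.
Unset Strict Implicit.
Unset Printing Implicit Defensive.

Import Order.TTheory GRing.Theory.
Local Open Scope ring_scope.

(* Ab-enriched categories. In an abelian category the group structure on the
   hom-sets is unique, so carrying it as data adds no information. *)
Record preaddCat := PreaddCat {
  obj :> Type;
  hom : obj -> obj -> zmodType;
  idm : forall A, hom A A;
  comp : forall A B D, hom B D -> hom A B -> hom A D;
  compA : forall A B D E (h : hom D E) (g : hom B D) (f : hom A B),
    comp h (comp g f) = comp (comp h g) f;
  comp1m : forall A B (f : hom A B), comp (idm B) f = f;
  compm1 : forall A B (f : hom A B), comp f (idm A) = f;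
  compDl : forall A B D (g g' : hom B D) (f : hom A B),
    comp (g + g') f = comp g f + comp g' f;
  compDr : forall A B D (g : hom B D) (f f' : hom A B),
    comp g (f + f') = comp g f + comp g f'
}.

Arguments hom {p} A B.
Arguments idm {p} A.
Arguments comp {p A B D} g f.
Notation "g \oc f" := (comp g f) (at level 40, left associativity).

Section PreaddTheory.
Variable C : preaddCat.
Implicit Types A B D X Z : C.

Lemma comp0m A B D (f : hom A B) : (0 : hom B D) \oc f = 0.
Proof. by apply: (addrI (0 \oc f)); rewrite -compDl !addr0. Qed.

Lemma compm0 A B D (g : hom B D) : g \oc (0 : hom A B) = 0.
Proof. by apply: (addrI (g \oc 0)); rewrite -compDr !addr0. Qed.

Lemma compNm A B D (g : hom B D) (f : hom A B) : (- g) \oc f = - (g \oc f).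
Proof. by apply: (addrI (g \oc f)); rewrite -compDl !subrr comp0m. Qed.

Lemma compmN A B D (g : hom B D) (f : hom A B) : g \oc (- f) = - (g \oc f).
Proof. by apply: (addrI (g \oc f)); rewrite -compDr !subrr compm0. Qed.

Lemma comp_suml (I : finType) A B D (g : I -> hom B D) (f : hom A B) :
  (\sum_i g i) \oc f = \sum_i (g i \oc f).
Proof.
by apply: (big_morph (fun g => g \oc f)) => [g1 g2|]; rewrite ?compDl ?comp0m.
Qed.

Lemma comp_sumr (I : finType) A B D (g : hom B D) (f : I -> hom A B) :
  g \oc (\sum_i f i) = \sum_i (g \oc f i).
Proof.
by apply: (big_morph (comp g)) => [f1 f2|]; rewrite ?compDr ?compm0.
Qed.

Definition is_iso A B (f : hom A B) :=
  exists g : hom B A, g \oc f = idm A /\ f \oc g = idm B.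

Definition monic A B (m : hom A B) :=
  forall X (u v : hom X A), m \oc u = m \oc v -> u = v.

Definition epic A B (e : hom A B) :=
  forall X (u v : hom B X), u \oc e = v \oc e -> u = v.

Definition is_kernel A B K (f : hom A B) (k : hom K A) :=
  f \oc k = 0 /\
  forall X (x : hom X A), f \oc x = 0 -> exists! u : hom X K, k \oc u = x.

Definition is_cokernel A B Q (f : hom A B) (q : hom B Q) :=
  q \oc f = 0 /\
  forall X (x : hom B X), x \oc f = 0 -> exists! u : hom Q X, u \oc q = x.

Definition is_zero_object Z :=
  forall X, (forall u v : hom Z X, u = v) /\ (forall u v : hom X Z, u = v).

Definition is_biproduct (I : finType) (A : I -> C) B
    (inj : forall i, hom (A i) B) (proj : forall i, hom B (A i)) :=
  [/\ forall i, proj i \oc inj i = idm (A i),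
      forall i j, i != j -> proj j \oc inj i = 0
    & \sum_i inj i \oc proj i = idm B].

(* The biproduct of the empty family is a zero object. *)
Record abelian : Prop := Abelian {
  ab_biproducts : forall (I : finType) (A : I -> C),
    exists B inj proj, @is_biproduct I A B inj proj;
  ab_kernels : forall A B (f : hom A B),
    exists K (k : hom K A), is_kernel f k;
  ab_cokernels : forall A B (f : hom A B),
    exists Q (q : hom B Q), is_cokernel f q;
  ab_monic_kernel : forall A B (m : hom A B), monic m ->
    exists D (g : hom B D), is_kernel g m;
  ab_epic_cokernel : forall A B (e : hom A B), epic e ->
    exists D (g : hom D A), is_cokernel g e
}.

Definition short_exact A B D (f : hom A B) (g : hom B D) :=
  is_kernel g f /\ is_cokernel f g.

(* [A --f--> B --g--> D] is exact at [B]: the mono part of the epi-mono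
   factorization of [f], i.e. the image of [f], is a kernel of [g]. *)
Definition exact_at A B D (f : hom A B) (g : hom B D) :=
  exists J (e : hom A J) (k : hom J B),
    [/\ epic e, is_kernel g k & f = k \oc e].

Definition injective_object J :=
  forall A B (m : hom A B) (u : hom A J), monic m ->
    exists v : hom B J, v \oc m = u.

Definition enough_injectives :=
  forall A, exists J (m : hom A J), injective_object J /\ monic m.

Record cochain := Cochain {
  coch :> nat -> C;
  codiff : forall n, hom (coch n) (coch n.+1);
  codiffK : forall n, codiff n.+1 \oc codiff n = 0
}.

Record coaug X := Coaug {
  coaug_cochain :> cochain;
  coaug_map : hom X (coaug_cochain 0)
}.

Definition is_injective_resolution X (J : coaug X) :=
  [/\ forall n, injective_object (J n),
      monic (coaug_map J),
      exact_at (coaug_map J) (codiff J 0)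
    & forall n, exact_at (codiff J n) (codiff J n.+1)].

Definition zero_diff_coaug X : coaug X :=
  @Coaug X (@Cochain (fun _ => X) (fun _ => 0) (fun _ => comp0m _ _)) (idm X).

(* A chosen injective resolution; [zero_diff_coaug X] is returned only if
   there is none, which does not happen in an abelian category with enough
   injectives. *)
Definition injres X : coaug X :=
  match pselect (exists J : coaug X, is_injective_resolution J) with
  | left h => projT1 (cid h)
  | right _ => zero_diff_coaug X
  end.

End PreaddTheory.

Section Cohomology.
Variables (C : preaddCat) (abC : abelian C).
Implicit Types A B D : C.

Lemma zero_object_exists : exists Z : C, is_zero_object Z.
Proof.
have [Z [inj [proj [_ _ id0]]]] := ab_biproducts abC (of_void C).
have {}id0 : idm Z = 0.
  by rewrite -id0 big_pred0 // => -[].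
exists Z => X; split=> u v.
  by rewrite -(compm1 u) -(compm1 v) id0 !compm0.
by rewrite -(comp1m u) -(comp1m v) id0 !comp0m.
Qed.

Definition zero_object : C := projT1 (cid zero_object_exists).

Lemma homology_exists A B D (f : hom A B) (g : hom B D) : g \oc f = 0 ->
  exists H K (k : hom K B) (u : hom A K) (q : hom K H),
    [/\ is_kernel g k, k \oc u = f & is_cokernel u q].
Proof.
move=> gf0; have [K [k kk]] := ab_kernels abC g.
have [u [ku _]] := kk.2 _ f gf0; have [H [q qq]] := ab_cokernels abC u.
by exists H, K, k, u, q.
Qed.

(* ker g / im f, as the cokernel of [f] corestricted to the kernel of [g]. *)
Definition homology A B D (f : hom A B) (g : hom B D) (gf0 : g \oc f = 0) : C :=
  projT1 (cid (homology_exists gf0)).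

Definition cohomology (K : cochain C) (d : nat) : C :=
  match d with
  | 0 => homology (compm0 zero_object (codiff K 0))
  | e.+1 => homology (codiffK K e)
  end.

End Cohomology.

Record addFunctor (A B : preaddCat) := AddFunctor {
  fob :> A -> B;
  fmap : forall X Y, hom X Y -> hom (fob X) (fob Y);
  fmap_id : forall X, fmap (idm X) = idm (fob X);
  fmap_comp : forall X Y Z (g : hom Y Z) (f : hom X Y),
    fmap (g \oc f) = fmap g \oc fmap f;
  fmapD : forall X Y (f g : hom X Y), fmap (f + g) = fmap f + fmap g
}.

Section Derived.
Variables (A B : preaddCat) (abB : abelian B) (F : addFunctor A B).

Lemma fmap0 X Y : fmap F (0 : hom X Y) = 0.
Proof. by apply: (addrI (fmap F 0)); rewrite -fmapD !addr0. Qed.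

Lemma fcochain_subproof (K : cochain A) n :
  fmap F (codiff K n.+1) \oc fmap F (codiff K n) = 0.
Proof. by rewrite -fmap_comp codiffK fmap0. Qed.

Definition fcochain (K : cochain A) : cochain B :=
  Cochain (fcochain_subproof K).

Definition rderived (d : nat) (X : A) : B :=
  cohomology abB (fcochain (injres X)) d.

End Derived.

Section Grothendieck.
Variable C : preaddCat.

(* [A] and [B] isomorphic gives a short exact sequence 0 -> 0 -> A -> B -> 0,
   so it does not matter that the free abelian group is taken on objects
   rather than on isomorphism classes. *)
Definition fcls (A : C) : {freeg {classic C}} := << (A : {classic C}) >>%R.

Definition groth_rel : {pred {freeg {classic C}}} := fun x =>
  `[< forall S : {pred {freeg {classic C}}}, zmod_closed S ->
      (forall (A B D : C) (f : hom A B) (g : hom B D), short_exact f g ->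
         fcls B - (fcls A + fcls D) \in S) ->
      x \in S >].

Lemma groth_rel_closed : zmod_closed groth_rel.
Proof.
split=> [|x y xS yS].
  by apply/asboolP => S Sc _; case: Sc.
apply/asboolP => S Sc Sr; case: (Sc) => _; apply.
  by move/asboolP: xS; apply.
by move/asboolP: yS; apply.
Qed.

HB.instance Definition _ :=
  GRing.isZmodClosed.Build {freeg {classic C}} groth_rel groth_rel_closed.

Definition groth : zmodType := Quotient.quot groth_rel.

Definition cls (A : C) : groth := (\pi_(Quotient.quot groth_rel) (fcls A))%qT.

End Grothendieck.

Section Modules.
Variables (disp : Order.disp_t) (P : porderType disp) (C : preaddCat).

Record pmodule := PModule {
  pmob :> P -> C;
  pmmap : forall a b, (a <= b)%O -> hom (pmob a) (pmob b);
  pmmap_id : forall a, pmmap (lexx a) = idm (pmob a);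
  pmmap_comp : forall a b c (ab : (a <= b)%O) (bc : (b <= c)%O),
    pmmap (le_trans ab bc) = pmmap bc \oc pmmap ab
}.

Record pmhom (M N : pmodule) := PMHom {
  pmcomp :> forall a, hom (M a) (N a);
  pmnat : forall a b (ab : (a <= b)%O),
    pmcomp b \oc pmmap M ab = pmmap N ab \oc pmcomp a
}.

Lemma pmhom_eq M N (s t : pmhom M N) : (forall a, s a = t a) -> s = t.
Proof.
case: s t => [s sn] [t tn] /= st.
have {}st : s = t by apply: functional_extensionality_dep.
by subst t; congr PMHom; exact: Prop_irrelevance.
Qed.

Section HomGroup.
Variables M N : pmodule.
Implicit Types s t r : pmhom M N.

Lemma pmhom0_subproof a b (ab : (a <= b)%O) :
  (0 : hom (M b) (N b)) \oc pmmap M ab = pmmap N ab \oc 0.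
Proof. by rewrite comp0m compm0. Qed.
Definition pmhom0 : pmhom M N := PMHom pmhom0_subproof.

Lemma pmhomN_subproof s a b (ab : (a <= b)%O) :
  (- s b) \oc pmmap M ab = pmmap N ab \oc (- s a).
Proof. by rewrite compNm compmN pmnat. Qed.
Definition pmhomN s : pmhom M N := PMHom (@pmhomN_subproof s).

Lemma pmhomD_subproof s t a b (ab : (a <= b)%O) :
  (s b + t b) \oc pmmap M ab = pmmap N ab \oc (s a + t a).
Proof. by rewrite compDl compDr !pmnat. Qed.
Definition pmhomD s t : pmhom M N := PMHom (@pmhomD_subproof s t).

HB.instance Definition _ := gen_eqMixin (pmhom M N).
HB.instance Definition _ := gen_choiceMixin (pmhom M N).

Lemma pmhom_addA : associative pmhomD.
Proof. by move=> s t r; apply: pmhom_eq => a; exact: addrA. Qed.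
Lemma pmhom_addC : commutative pmhomD.
Proof. by move=> s t; apply: pmhom_eq => a; exact: addrC. Qed.
Lemma pmhom_add0 : left_id pmhom0 pmhomD.
Proof. by move=> s; apply: pmhom_eq => a; exact: add0r. Qed.
Lemma pmhom_addN : left_inverse pmhom0 pmhomN pmhomD.
Proof. by move=> s; apply: pmhom_eq => a; exact: addNr. Qed.

HB.instance Definition _ := GRing.isZmodule.Build (pmhom M N)
  pmhom_addA pmhom_addC pmhom_add0 pmhom_addN.

End HomGroup.

Definition pmid M : pmhom M M.
Proof.
by exists (fun a => idm (M a)) => a b ab; rewrite comp1m compm1.
Defined.

Definition pmcirc L M N (t : pmhom M N) (s : pmhom L M) : pmhom L N.
Proof.
exists (fun a => t a \oc s a) => a b ab.
by rewrite -compA pmnat compA pmnat compA.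
Defined.

Definition pmodCat : preaddCat.
Proof.
apply: (@PreaddCat pmodule (fun M N => pmhom M N) pmid pmcirc).
- by move=> *; apply: pmhom_eq => a; exact: compA.
- by move=> *; apply: pmhom_eq => a; exact: comp1m.
- by move=> *; apply: pmhom_eq => a; exact: compm1.
- by move=> *; apply: pmhom_eq => a; exact: compDl.
- by move=> *; apply: pmhom_eq => a; exact: compDr.
Defined.

End Modules.

Definition pullback (d1 d2 : Order.disp_t) (P : porderType d1)
    (Q : porderType d2) (C : preaddCat) (h : P -> Q)
    (hmono : {homo h : a b / (a <= b)%O}) (N : pmodule Q C) : pmodule P C.
Proof.
exists (fun a => N (h a)) (fun a b ab => pmmap N (hmono a b ab)).
- by move=> a; rewrite -pmmap_id; congr pmmap; exact: bool_irrelevance.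
- move=> a b c ab bc; rewrite -pmmap_comp; congr pmmap.
  exact: bool_irrelevance.
Defined.

Record closedSymMonoidal (C : preaddCat) := ClosedSymMonoidal {
  unit_ob : C;
  tens : C -> C -> C;
  tensm : forall A A' B B', hom A A' -> hom B B' -> hom (tens A B) (tens A' B');
  tensm_id : forall A B, tensm (idm A) (idm B) = idm (tens A B);
  tensm_comp : forall A A' A'' B B' B''
    (f' : hom A' A'') (f : hom A A') (g' : hom B' B'') (g : hom B B'),
    tensm (f' \oc f) (g' \oc g) = tensm f' g' \oc tensm f g;

  assoc : forall A B D, hom (tens (tens A B) D) (tens A (tens B D));
  assoc_iso : forall A B D, is_iso (assoc A B D);
  assoc_nat : forall A A' B B' D D' (f : hom A A') (g : hom B B') (h : hom D D'),
    assoc A' B' D' \oc tensm (tensm f g) h =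
    tensm f (tensm g h) \oc assoc A B D;

  lunit : forall A, hom (tens unit_ob A) A;
  lunit_iso : forall A, is_iso (lunit A);
  lunit_nat : forall A A' (f : hom A A'),
    lunit A' \oc tensm (idm unit_ob) f = f \oc lunit A;

  runit : forall A, hom (tens A unit_ob) A;
  runit_iso : forall A, is_iso (runit A);
  runit_nat : forall A A' (f : hom A A'),
    runit A' \oc tensm f (idm unit_ob) = f \oc runit A;

  pentagon : forall A B D E,
    assoc A B (tens D E) \oc assoc (tens A B) D E =
    tensm (idm A) (assoc B D E) \oc assoc A (tens B D) E
      \oc tensm (assoc A B D) (idm E);
  triangle : forall A B,
    tensm (idm A) (lunit B) \oc assoc A unit_ob B = tensm (runit A) (idm B);

  braid : forall A B, hom (tens A B) (tens B A);
  braid_nat : forall A A' B B' (f : hom A A') (g : hom B B'),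
    braid A' B' \oc tensm f g = tensm g f \oc braid A B;
  braid_sym : forall A B, braid B A \oc braid A B = idm (tens A B);
  hexagon : forall A B D,
    assoc B D A \oc braid A (tens B D) \oc assoc A B D =
    tensm (idm B) (braid A D) \oc assoc B A D \oc tensm (braid A B) (idm D);

  ihom : C -> C -> C;
  ev : forall A B, hom (tens (ihom A B) A) B;
  curry : forall X A B, hom (tens X A) B -> hom X (ihom A B);
  curryK : forall X A B (u : hom (tens X A) B),
    ev A B \oc tensm (curry u) (idm A) = u;
  curry_uniq : forall X A B (v : hom X (ihom A B)),
    curry (ev A B \oc tensm v (idm A)) = v
}.

Arguments curry {C} c {X A B} u.
Arguments tensm {C} c {A A' B B'} f g : rename.

Record abCSMCat := AbCSMCat {
  base_cat :> preaddCat;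
  base_abelian : abelian base_cat;
  base_csm :> closedSymMonoidal base_cat
}.

Section InternalHom.
Variable C : abCSMCat.
Implicit Types A B X Z : C.

Local Notation "A '\ox' B" := (tens C A B) (at level 40, left associativity).
Local Notation tm := (tensm C).

Lemma ihom_eq X A B (u v : hom X (ihom C A B)) :
  ev C A B \oc tm u (idm A) = ev C A B \oc tm v (idm A) -> u = v.
Proof. by move=> uv; rewrite -(curry_uniq u) -(curry_uniq v) uv. Qed.

Lemma curry_inj X A B (u v : hom (X \ox A) B) : curry C u = curry C v -> u = v.
Proof. by move=> uv; rewrite -(curryK u) -(curryK v) uv. Qed.

Lemma curry_comp X Y A B (u : hom (Y \ox A) B) (f : hom X Y) :
  curry C u \oc f = curry C (u \oc tm f (idm A)).
Proof.
apply: ihom_eq; rewrite curryK -{2}(curryK u) -compA -tensm_comp.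
by rewrite comp1m.
Qed.

Lemma tensm0 X Y A : tm (0 : hom X Y) (idm A) = 0.
Proof.
apply: curry_inj; rewrite -[tm 0 _]comp1m -curry_comp compm0.
by rewrite -[0 in RHS](comp0m _ (tm (0 : hom X X) (idm A))) -curry_comp compm0.
Qed.

Lemma tensmDl X Y A (f g : hom X Y) :
  tm (f + g) (idm A) = tm f (idm A) + tm g (idm A).
Proof.
have [S [inj [proj [pi1 pi0 sum1]]]] :=
  ab_biproducts (base_abelian C) (fun _ : bool => X).
have S_ext W (u v : hom (S \ox A) W) :
    (forall b, u \oc tm (inj b) (idm A) = v \oc tm (inj b) (idm A)) -> u = v.
  move=> uv; apply: curry_inj.
  rewrite -(compm1 (curry C u)) -(compm1 (curry C v)) -sum1 !comp_sumr.
  by apply: eq_bigr => b _; rewrite !compA !curry_comp uv.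
pose h : hom S Y := f \oc proj true + g \oc proj false.
have h_inj b : h \oc inj b = if b then f else g.
  rewrite compDl -!compA; case: b; rewrite pi1 pi0 // compm0 compm1.
    by rewrite addr0.
  by rewrite add0r.
have tm_h : tm h (idm A) = tm f (idm A) \oc tm (proj true) (idm A) +
                           tm g (idm A) \oc tm (proj false) (idm A).
  apply: S_ext => b; rewrite compDl -!compA -!tensm_comp h_inj !comp1m.
  by case: b; rewrite pi1 pi0 // compm0 compm1 tensm0 ?addr0 ?add0r.
pose dg : hom X S := inj true + inj false.
have p_dg b : proj b \oc dg = idm X.
  by rewrite compDr; case: b; rewrite pi1 pi0 // ?addr0 ?add0r.
have -> : f + g = h \oc dg by rewrite compDr !h_inj.
rewrite -{1}(comp1m (idm A)) tensm_comp tm_h compDl -!compA -!tensm_comp.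
by rewrite !p_dg !comp1m !compm1.
Qed.

Definition ihomm A A' B B' (f : hom A' A) (g : hom B B') :
    hom (ihom C A B) (ihom C A' B') :=
  curry C (g \oc ev C A B \oc tm (idm (ihom C A B)) f).

Lemma ihommE A A' B B' (f : hom A' A) (g : hom B B') :
  ev C A' B' \oc tm (ihomm f g) (idm A') =
  g \oc ev C A B \oc tm (idm (ihom C A B)) f.
Proof. exact: curryK. Qed.

Lemma ihomm_id A B : ihomm (idm A) (idm B) = idm (ihom C A B).
Proof. by apply: ihom_eq; rewrite ihommE comp1m. Qed.

Lemma ihomm_comp A A' A'' B B' B'' (f : hom A' A) (f' : hom A'' A')
    (g : hom B B') (g' : hom B' B'') :
  ihomm (f \oc f') (g' \oc g) = ihomm f' g' \oc ihomm f g.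
Proof.
have tm_split X Y Z (u : hom Y Z) (v : hom X Y) :
    tm (u \oc v) (idm A'') = tm u (idm A'') \oc tm v (idm A'').
  by rewrite -tensm_comp comp1m.
apply: ihom_eq; rewrite ihommE tm_split compA ihommE -(compA _ _ (tm _ (idm A''))).
have -> : tm (idm (ihom C A' B')) f' \oc tm (ihomm f g) (idm A'') =
          tm (ihomm f g) (idm A') \oc tm (idm (ihom C A B)) f'.
  by rewrite -!tensm_comp !comp1m !compm1.
rewrite compA -(compA g' (ev _ _ _)) ihommE -!compA -tensm_comp.
by rewrite comp1m.
Qed.

Lemma ihommDr A A' B B' (f : hom A' A) (g g' : hom B B') :
  ihomm f (g + g') = ihomm f g + ihomm f g'.
Proof.
by apply: ihom_eq; rewrite tensmDl compDr !ihommE -!compA compDl.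
Qed.

End InternalHom.

Section Ext.
Variables (disp : Order.disp_t) (P : finPOrderType disp) (C : abCSMCat).
Implicit Types M N : pmodule P C.

Definition is_wedge M N (E : C) (p : forall a, hom E (ihom C (M a) (N a))) :=
  forall a b (ab : (a <= b)%O),
    ihomm (idm (M a)) (pmmap N ab) \oc p a =
    ihomm (pmmap M ab) (idm (N b)) \oc p b.

Definition is_end M N (E : C) (p : forall a, hom E (ihom C (M a) (N a))) :=
  is_wedge p /\
  forall (X : C) (x : forall a, hom X (ihom C (M a) (N a))), is_wedge x ->
    exists! u : hom X E, forall a, p a \oc u = x a.

Lemma end_exists M N : exists (E : C) p, @is_end M N E p.
Proof.
have abC := base_abelian C.
have [S [si [sp [sii si0 s1]]]] :=
  ab_biproducts abC (fun a : P => ihom C (M a) (N a)).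
pose I : finType := {ab : P * P | (ab.1 <= ab.2)%O}.
have [T [ti [tp [tii ti0 t1]]]] :=
  ab_biproducts abC (fun i : I => ihom C (M (val i).1) (N (val i).2)).
pose w (i : I) : hom S (ihom C (M (val i).1) (N (val i).2)) :=
  ihomm (idm (M (val i).1)) (pmmap N (valP i)) \oc sp _ -
  ihomm (pmmap M (valP i)) (idm (N (val i).2)) \oc sp _.
pose phi := \sum_i ti i \oc w i.
have tp_phi i : tp i \oc phi = w i.
  rewrite comp_sumr (bigD1 i) //= compA tii comp1m big1 ?addr0 // => j ji.
  by rewrite compA ti0 ?comp0m.
have [E [k [k0 ku]]] := ab_kernels abC phi.
have k_w i : w i \oc k = 0 by rewrite -tp_phi -compA k0 compm0.
have sp_sum X (x : forall a, hom X (ihom C (M a) (N a))) a :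
    sp a \oc (\sum_b si b \oc x b) = x a.
  rewrite comp_sumr (bigD1 a) //= compA sii comp1m big1 ?addr0 // => j ji.
  by rewrite compA si0 ?comp0m.
exists E, (fun a => sp a \oc k); split=> [a b ab|X x xw].
  have := k_w (exist _ (a, b) ab : I); rewrite /w compDl compNm => /subr0_eq.
  rewrite -!compA; move: (valP _) => /= ab'.
  by rewrite (bool_irrelevance ab' ab).
pose y := \sum_b si b \oc x b.
have y0 : phi \oc y = 0.
  rewrite comp_suml big1 // => i _; rewrite -compA compDl compNm -!compA.
  by rewrite !sp_sum xw subrr compm0.
have [u [ku1 u_uniq]] := ku _ y y0; exists u; split=> [a|v kv].
  by rewrite -compA ku1 sp_sum.
apply: u_uniq; rewrite -[k \oc v]comp1m -s1 comp_suml.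
by rewrite /y; apply: eq_bigr => a _; rewrite -compA compA -kv !compA.
Qed.

Definition Homob M N : C := projT1 (cid (end_exists M N)).

Definition Hompr M N : forall a, hom (Homob M N) (ihom C (M a) (N a)) :=
  projT1 (cid (projT2 (cid (end_exists M N)))).

Lemma HomP M N : is_end (Hompr M N).
Proof. exact: projT2 (cid (projT2 (cid (end_exists M N)))). Qed.

Lemma Hom_ext M N X (u v : hom X (Homob M N)) :
  (forall a, Hompr M N a \oc u = Hompr M N a \oc v) -> u = v.
Proof.
move=> uv; have [wdg un] := HomP M N.
have xw : is_wedge (fun a => Hompr M N a \oc v).
  by move=> a b ab; rewrite !compA wdg.
by have [w [_ w_uniq]] := un _ _ xw; rewrite -(w_uniq u uv) -(w_uniq v).
Qed.

Lemma Hommap_exists M N N' (s : pmhom N N') :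
  exists u : hom (Homob M N) (Homob M N'),
    forall a, Hompr M N' a \oc u = ihomm (idm (M a)) (s a) \oc Hompr M N a.
Proof.
have [wdg _] := HomP M N; have [_ un] := HomP M N'.
suff xw : is_wedge (fun a => ihomm (idm (M a)) (s a) \oc Hompr M N a).
  by have [u [uP _]] := un _ _ xw; exists u.
move=> a b ab; rewrite !compA -!ihomm_comp !comp1m -pmnat.
rewrite -{1}[idm (M a)]comp1m ihomm_comp -compA wdg compA -ihomm_comp.
by rewrite !compm1.
Qed.

Definition Hommap M N N' (s : pmhom N N') : hom (Homob M N) (Homob M N') :=
  projT1 (cid (Hommap_exists M s)).

Lemma HommapE M N N' (s : pmhom N N') a :
  Hompr M N' a \oc Hommap M s = ihomm (idm (M a)) (s a) \oc Hompr M N a.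
Proof. exact: (projT2 (cid (Hommap_exists M s))). Qed.

Definition HomFunctor M : addFunctor (pmodCat P C) C.
Proof.
apply: (@AddFunctor (pmodCat P C) C (Homob M) (@Hommap M)).
- by move=> N; apply: Hom_ext => a; rewrite HommapE ihomm_id comp1m compm1.
- move=> N N' N'' t s; apply: Hom_ext => a.
  rewrite compA !HommapE -compA HommapE compA -ihomm_comp.
  by rewrite comp1m.
- move=> N N' s t; apply: Hom_ext => a.
  by rewrite compDr !HommapE ihommDr compDl.
Defined.

Definition Ext (d : nat) M N : C :=
  rderived (base_abelian C) (HomFunctor M) d (N : pmodCat P C).

(* [\sum_(d \in A)] is the sum over the support when that support is finite,
   hence the alternating sum as soon as the Ext objects vanish for large [d]. *)
Definition chi M N : groth C :=
  \sum_(d \in [set: nat]) cls (Ext d M N) *~ (-1) ^+ d.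

Definition sky_ob (t : bool) : C :=
  if t then unit_ob C else zero_object (base_abelian C).

Definition sky_map (t u : bool) : hom (sky_ob t) (sky_ob u) :=
  match t, u with
  | true, true => idm (unit_ob C)
  | _, _ => 0
  end.

Definition skyscraper (a : P) : pmodule P C.
Proof.
exists (fun b => sky_ob (b == a)) (fun b c _ => sky_map (b == a) (c == a)).
- move=> b; case: (b == a) => //=.
  exact: ((projT2 (cid (zero_object_exists (base_abelian C)))) _).1.
- move=> b c e bc ce; case: (b =P a) => [ba|_]; last first.
    by case: (c == a); rewrite /= compm0.
  case: (e =P a) => [ea|_]; last by case: (c == a); rewrite /= comp0m.
  rewrite (_ : c == a) /= ?comp1m //.
  by rewrite eq_le -{1}ea ce -ba bc.
Defined.

End Ext.

Section Moebius.
Variables (disp : Order.disp_t) (P : finPOrderType disp).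

(* Functions on the intervals [a, b] are represented by functions of the pair
   (a, b); their values at pairs with [~~ (a <= b)] are irrelevant. *)
Definition convol (al be : P -> P -> int) (a c : P) : int :=
  \sum_(b | (a <= b <= c)%O) al a b * be b c.

Definition zeta (a b : P) : int := 1.

Definition delta (a b : P) : int := (a == b)%:R.

Definition is_mobius (mu : P -> P -> int) :=
  forall a c, (a <= c)%O ->
    convol mu zeta a c = delta a c /\ convol zeta mu a c = delta a c.

Lemma triangular_solve (r : rel P) (D : pred P) (k : P -> int) :
  irreflexive r -> transitive r ->
  exists h : P -> int, forall c, h c = k c - \sum_(b | D b && r b c) h b.
Proof.
move=> rirr rtr.
pose fix h (n : nat) (c : P) {struct n} : int :=
  if n is n'.+1 then k c - \sum_(b | D b && r b c) h n' b else 0.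
have below b c : r b c -> (#|[pred e | r e b]| < #|[pred e | r e c]|)%N.
  move=> bc; apply: proper_card; apply/properP; split.
    by apply/fintype.subsetP => e; rewrite !inE => /rtr; apply.
  by exists b; rewrite !inE ?bc // rirr.
have stable n m c : (#|[pred e | r e c]| < n)%N ->
    (#|[pred e | r e c]| < m)%N -> h n c = h m c.
  elim: n m c => [|n IH] [|m] c //= cn cm; congr (_ - _).
  apply: eq_bigr => b /andP[_ /below bc].
  by apply: IH; [exact: leq_trans bc cn | exact: leq_trans bc cm].
have hS n c : h n.+1 c = k c - \sum_(b | D b && r b c) h n b by [].
exists (fun c => h #|[pred e | r e c]|.+1 c) => c; rewrite hS; congr (_ - _).
apply: eq_bigr => b /andP[_ /below bc]; exact: stable.
Qed.

Lemma mobius_exists : exists mu, is_mobius mu.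
Proof.
have /choice[mu muP] a := triangular_solve (fun b => (a <= b)%O) (delta a)
  (@ltxx _ P) (@lt_trans _ P).
have /choice[nu nuP] c := triangular_solve (r := fun a b : P => (b < a)%O)
  (fun b => (b <= c)%O) (fun a => delta a c) (@ltxx _ P)
  (fun x y z (yx : (x < y)%O) zx => lt_trans zx yx).
have mu_zeta a c : (a <= c)%O -> convol mu zeta a c = delta a c.
  move=> ac; rewrite /convol (bigD1 c) /= ?ac ?lexx // mulr1 muP.
  rewrite [X in _ - X](eq_bigl (fun b => (a <= b <= c)%O && (b != c))).
    rewrite [X in _ + X](eq_bigr (mu a)) ?subrK // => b _; exact: mulr1.
  by move=> b; rewrite lt_neqAle -andbA; congr andb; rewrite andbC.
have zeta_nu a c : (a <= c)%O ->
    convol zeta (fun a c => nu c a) a c = delta a c.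
  move=> ac; rewrite /convol (bigD1 a) /= ?ac ?lexx // mul1r nuP.
  rewrite [X in _ - X](eq_bigl (fun b => (a <= b <= c)%O && (b != a))).
    rewrite [X in _ + X](eq_bigr (nu c)) ?subrK // => b _; exact: mul1r.
  by move=> b; rewrite lt_def andbC -!andbA; do !bool_congr.
have mu_nu a c : (a <= c)%O -> mu a c = nu c a.
  move=> ac.
  transitivity (\sum_(b | (a <= b <= c)%O)
      \sum_(e | (b <= e <= c)%O) mu a b * nu c e).
    rewrite (bigD1 c) /= ?ac ?lexx // [X in _ + X]big1 ?addr0 => [|b].
      rewrite -mulr_sumr.
      have := zeta_nu c c (lexx c); rewrite /convol /zeta /delta eqxx.
      under eq_bigr do rewrite mul1r.
      by move=> ->; rewrite mulr1.
    case/andP => /andP[_ bc] bNc; rewrite -mulr_sumr.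
    have := zeta_nu b c bc; rewrite /convol /zeta /delta (negPf bNc).
    under eq_bigr do rewrite mul1r.
    by move=> ->; rewrite mulr0.
  rewrite (exchange_big_dep (fun e => (a <= e <= c)%O)) /=; last first.
    by move=> b e /andP[ab _] /andP[be ->]; rewrite (le_trans ab be).
  transitivity (\sum_(e | (a <= e <= c)%O) delta a e * nu c e).
    apply: eq_bigr => e /andP[ae ec]; rewrite -mulr_suml -(mu_zeta a e ae).
    congr (_ * _); rewrite /convol; apply: eq_big => b; last by rewrite mulr1.
    rewrite ec andbT; case: (boolP (b <= e)%O) => be; rewrite ?andbF //.
    by rewrite (le_trans be ec) !andbT.
  rewrite (bigD1 a) /= ?ac ?lexx // big1 ?addr0 => [|e /andP[_ ea]].
    by rewrite /delta eqxx mul1r.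
  by rewrite /delta eq_sym (negPf ea) mul0r.
exists mu => a c ac; split; first exact: mu_zeta.
rewrite -zeta_nu // /convol; apply: eq_bigr => b /andP[_ bc].
by rewrite mu_nu.
Qed.

Definition mobius : P -> P -> int := projT1 (cid mobius_exists).

Definition mobius_inversion (V : zmodType) (m : P -> V) (a : P) : V :=
  \sum_(b | (a <= b)%O) m b *~ mobius a b.

End Moebius.

Record galois_connection (d1 d2 : Order.disp_t) (P : porderType d1)
    (Q : porderType d2) (f : P -> Q) (g : Q -> P) : Prop := GaloisConnection {
  galois_monol : {homo f : a b / (a <= b)%O};
  galois_monor : {homo g : x y / (x <= y)%O};
  galois_adj : forall a x, (f a <= x)%O = (a <= g x)%O
}.

Definition fun_pullback (T U : Type) (V : zmodType) (f : T -> U)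
    (n : U -> V) : T -> V := fun a => n (f a).

Definition fun_pushforward (T : finType) (U : eqType) (V : zmodType)
    (g : T -> U) (m : T -> V) : U -> V := fun a => \sum_(x | g x == a) m x.

(* Main.v *)
From Pilot Require Import Defs.
From HB Require Import structures.
From mathcomp Require Import all_boot all_order all_algebra.
From mathcomp Require Import boolp classical_sets fsbigop.

Import Pilot.Defs.

(** Both Euler characteristics are instances of one formula: for an
    interval-closed subset [S] of a finite poset [P], with [1_S] the module that is the
    unit on [S] and zero elsewhere,
      [chi (1_S, N) = \sum_(b | S b) mobius_inversion [N] b].
    The simple module at [a] is [1_S] for [S = {a}], and its pullback along
    [g] is [1_S] for [S] the fiber of [g] over [a]. The formula thus turns the
    two characteristics into the two Moebius inversions of the statement, which
    agree by Rota's theorem on Galois connections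
    ([mobius_inversion_galois]).

    The formula ([chi_indicator]) rests on reading [Hom (1_S, X)] as the object
    of sections of [X] over [S] ([Hom_represents_sections]): generalized
    elements [x c] of the [X c] for [c] in [S], compatible with the arrows of
    [X], and killed by every arrow that leaves [S]. View [X] as a sheaf on [P],
    with the upward closed sets as open sets. If [X] is flabby, removing a
    minimal element [b] from [S] gives a short exact sequence from the sections
    over [b] alone, through those over [S], to those over the rest, so the
    class of [Hom (1_S, X)] is a sum of contributions of the elements of [S].
    For [S = (>= a)] the sections form [X a], hence these contributions are the
    Moebius inverse of the classes of [X] ([cls_flabby_sections]).

    A general [N] is handled through an injective resolution [J] with
    cosyzygies [Z n]. Injective modules are flabby ([injective_flabby]), and
    each step of the resolution makes one more layer of [P], counted from the
    top, flabby ([flabby_cokernel]); so [Z n] is flabby once [n] exceeds the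
    size of [P]. Let [D n] be the class of [Hom (1_S, Z n)] minus its expected
    value. Since [Hom (1_S, _)] preserves kernels, the class of the Ext object
    of degree [n.+1] is [D n + D n.+1]; the alternating sum telescopes, and [D]
    vanishes for large [n].

    The resolution has to be known to exist, so modules over [P] are shown to
    form an abelian category with enough injectives. Diagram chases use
    generalized elements, which lift along epimorphisms after passing to an
    epimorphic cover ([epic_lift]). *)

Set Implicit Arguments.
Unset Strict Implicit.
Unset Printing Implicit Defensive.

Import Order.TTheory GRing.Theory.
Local Open Scope ring_scope.

(** * Kernels, cokernels and epimorphisms in an abelian category *)

Section Preadditive.
Variable C : preaddCat.
Implicit Types A B D K Q X : C.

Lemma monicP A B (m : hom A B) :
  (forall X (u : hom X A), m \oc u = 0 -> u = 0) -> monic m.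
Proof.
move=> m0 X u v uv; apply/eqP; rewrite -subr_eq0; apply/eqP/m0.
by rewrite compDr compmN uv subrr.
Qed.

Lemma epicP A B (e : hom A B) :
  (forall X (u : hom B X), u \oc e = 0 -> u = 0) -> epic e.
Proof.
move=> e0 X u v uv; apply/eqP; rewrite -subr_eq0; apply/eqP/e0.
by rewrite compDl compNm uv subrr.
Qed.

Lemma monic0 A B X (m : hom A B) (u : hom X A) :
  monic m -> m \oc u = 0 -> u = 0.
Proof. by move=> mm mu0; apply: mm; rewrite mu0 compm0. Qed.

Lemma epic0 A B X (e : hom A B) (u : hom B X) : epic e -> u \oc e = 0 -> u = 0.
Proof. by move=> ee ue0; apply: ee; rewrite ue0 comp0m. Qed.

Lemma epic_comp A B D (g : hom B D) (f : hom A B) :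
  epic g -> epic f -> epic (g \oc f).
Proof. by move=> eg ef X u v; rewrite !compA => /ef/eg. Qed.

Lemma epic_id A : epic (idm A).
Proof. by move=> X u v; rewrite !compm1. Qed.

Lemma epic_factor A B D (g : hom B D) (f : hom A B) :
  epic (g \oc f) -> epic g.
Proof. by move=> gf X u v uv; apply: gf; rewrite !compA uv. Qed.

Lemma kernel_monic A B K (f : hom A B) (k : hom K A) :
  is_kernel f k -> monic k.
Proof.
move=> [fk0 kU] X u v kuv; have fku0 : f \oc (k \oc u) = 0.
  by rewrite compA fk0 comp0m.
have [w [_ wU]] := kU X (k \oc u) fku0.
by rewrite -(wU u erefl) -(wU v (esym kuv)).
Qed.

Lemma cokernel_epic A B Q (f : hom A B) (q : hom B Q) :
  is_cokernel f q -> epic q.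
Proof.
move=> [qf0 qU] X u v quv; have uqf0 : (u \oc q) \oc f = 0.
  by rewrite -compA qf0 compm0.
have [w [_ wU]] := qU X (u \oc q) uqf0.
by rewrite -(wU u erefl) -(wU v (esym quv)).
Qed.

Lemma kernel_lift A B K X (f : hom A B) (k : hom K A) (x : hom X A) :
  is_kernel f k -> f \oc x = 0 -> exists u, k \oc u = x.
Proof. by move=> [_ kU] /kU[u [ku _]]; exists u. Qed.

Lemma is_kernelP A B K (f : hom A B) (k : hom K A) :
  monic k -> f \oc k = 0 ->
  (forall X (x : hom X A), f \oc x = 0 -> exists u, k \oc u = x) ->
  is_kernel f k.
Proof.
move=> mk fk0 kL; split=> // X x /kL[u ku]; exists u; split=> // v kv.
by apply: mk; rewrite ku.
Qed.

Lemma is_cokernelP A B Q (f : hom A B) (q : hom B Q) :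
  epic q -> q \oc f = 0 ->
  (forall X (x : hom B X), x \oc f = 0 -> exists u, u \oc q = x) ->
  is_cokernel f q.
Proof.
move=> eq qf0 qL; split=> // X x /qL[u qu]; exists u; split=> // v qv.
by apply: eq; rewrite qu.
Qed.

Lemma is_kernel_monic_comp A B D K (m : hom B D) (f : hom A B) (k : hom K A) :
  monic m -> is_kernel (m \oc f) k <-> is_kernel f k.
Proof.
move=> mm; split=> kk; (apply: is_kernelP; first exact: kernel_monic kk).
- by apply: (monic0 mm); rewrite compA; exact: kk.1.
- by move=> X x fx; apply: (kernel_lift kk); rewrite -compA fx compm0.
- by rewrite -compA kk.1 compm0.
- by move=> X x; rewrite -compA => /(monic0 mm); exact: kernel_lift.
Qed.

Lemma is_cokernel_epic_factor A B D Q (e : hom A B) (f : hom B D)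
    (q : hom D Q) :
  epic e -> is_cokernel (f \oc e) q -> is_cokernel f q.
Proof.
move=> ee [qf0 qU]; split=> [|X x xf0].
  by apply: (epic0 ee); rewrite -compA.
by apply: qU; rewrite compA xf0 comp0m.
Qed.

Lemma zero_object_homl (Z X : C) (u v : hom Z X) : is_zero_object Z -> u = v.
Proof. by move=> Z0; exact: (Z0 X).1. Qed.

Lemma zero_object_homr (Z X : C) (u v : hom X Z) : is_zero_object Z -> u = v.
Proof. by move=> Z0; exact: (Z0 X).2. Qed.

End Preadditive.

Section Abelian.
Variables (C : preaddCat) (abC : abelian C).
Implicit Types A B D K Q X : C.

Lemma zero_objectP : is_zero_object (zero_object abC).
Proof. exact: projT2 (cid (zero_object_exists abC)). Qed.

Lemma epic_cokernel_kernel A B K (e : hom A B) (k : hom K A) :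
  epic e -> is_kernel e k -> is_cokernel k e.
Proof.
move=> ee [ek0 kU]; have [D [g [eg0 gU]]] := ab_epic_cokernel abC ee.
split=> // X x xk0; apply: gU; have [h [kh _]] := kU _ g eg0.
by rewrite -kh compA xk0 comp0m.
Qed.

Lemma monic_kernel_cokernel A B Q (m : hom A B) (q : hom B Q) :
  monic m -> is_cokernel m q -> is_kernel q m.
Proof.
move=> mm [qm0 qU]; have [D [g [gm0 gU]]] := ab_monic_kernel abC mm.
split=> // X x qx0; apply: gU; have [h [hq _]] := qU _ g gm0.
by rewrite -hq -compA qx0 compm0.
Qed.

Lemma monic_epic_section A B (f : hom A B) :
  monic f -> epic f -> exists h, f \oc h = idm B.
Proof.
move=> mf ef; have [D [g gf]] := ab_monic_kernel abC mf.
by apply: (kernel_lift gf); rewrite compm1; exact: epic0 gf.1.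
Qed.

Lemma binary_biproduct A B : exists S (i1 : hom A S) (i2 : hom B S)
    (p1 : hom S A) (p2 : hom S B),
  [/\ p1 \oc i1 = idm A, p2 \oc i2 = idm B, p1 \oc i2 = 0, p2 \oc i1 = 0
    & i1 \oc p1 + i2 \oc p2 = idm S].
Proof.
have [S [i [p [pi1 pi0 s1]]]] :=
  ab_biproducts abC (fun b : bool => if b then A else B).
exists S, (i true), (i false), (p true), (p false).
split; [exact: (pi1 true)|exact: (pi1 false)|exact: (pi0 false true)|
  exact: (pi0 true false)|].
by rewrite -s1 big_bool.
Qed.

(** Epimorphisms are stable under pullback. This licenses diagram chases with
    generalized elements [T -> B]: an element of the target of an epimorphism
    lifts to the source after [T] is replaced by an epimorphic cover. *)
Lemma epic_lift A B T (e : hom A B) (y : hom T B) : epic e ->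
  exists T' (t : hom T' T) (x : hom T' A), epic t /\ e \oc x = y \oc t.
Proof.
move=> ee; have [S [i1 [i2 [p1 [p2 [p11 p22 p12 p21 s1]]]]]] :=
  binary_biproduct A T.
(* The kernel of [h] is the pullback of [e] and [y]. *)
pose h := e \oc p1 - y \oc p2.
have hi1 : h \oc i1 = e.
  by rewrite compDl compNm -!compA p11 p21 compm1 compm0 subr0.
have hi2 : h \oc i2 = - y.
  by rewrite compDl compNm -!compA p12 p22 compm1 compm0 add0r.
have eh : epic h by apply: (@epic_factor _ _ _ _ _ i1); rewrite hi1.
have [K [k kk]] := ab_kernels abC h; have [hk0 _] := kk.
exists K, (p2 \oc k), (p1 \oc k); split; last first.
  by apply/eqP; rewrite -subr_eq0 !compA -compNm -compDl; apply/eqP.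
apply: epicP => X u upk0.
have [_ hU] := epic_cokernel_kernel eh kk.
have [|w [wh _]] := hU _ (u \oc p2); first by rewrite -compA.
have w0 : w = 0.
  by apply: (epic0 ee); rewrite -hi1 compA wh -compA p21 compm0.
by rewrite -[u]compm1 -p22 compA -wh w0 !comp0m.
Qed.

(** The first isomorphism theorem. *)
Lemma monic_of_coimage A B K I (f : hom A B) (k : hom K A) (e : hom A I)
    (m : hom I B) :
  is_kernel f k -> is_cokernel k e -> f = m \oc e -> monic m.
Proof.
move=> kk ke fme; apply: monicP => X x mx0.
have [T [t [a [et ea]]]] := epic_lift x (cokernel_epic ke).
apply: (epic0 et); rewrite -ea.
have [|b <-] := kernel_lift (x := a) kk.
  by rewrite fme -compA ea compA mx0 comp0m.
by rewrite compA ke.1 comp0m.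
Qed.

End Abelian.

(** * Classes in the Grothendieck group *)

Section Grothendieck.
Variables (C : preaddCat) (abC : abelian C).
Implicit Types A B D K Q X : C.

Lemma cls_short_exact A B D (f : hom A B) (g : hom B D) :
  short_exact f g -> cls B = cls A + cls D.
Proof.
move=> fg; rewrite /cls -raddfD /=; apply/eqP.
rewrite -Quotient.idealrBE; apply/asboolP => S Sc Sr; exact: Sr fg.
Qed.

Lemma cls_kernel K A B (k : hom K A) (e : hom A B) :
  is_kernel e k -> epic e -> cls A = cls K + cls B.
Proof.
move=> kk ee; apply: (cls_short_exact (f := k) (g := e)).
by split=> //; exact: epic_cokernel_kernel.
Qed.

Lemma cls_zero A : is_zero_object A -> cls A = 0.
Proof.
move=> A0; apply: (addrI (cls A)); rewrite addr0; apply: esym.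
apply: (@cls_kernel A A A 0 0).
  apply: is_kernelP => [X u v _||X x _]; first exact: zero_object_homr.
    by rewrite comp0m.
  by exists 0; exact: zero_object_homr.
by move=> X u v _; exact: zero_object_homl.
Qed.

Lemma cls_iso A B (f : hom A B) (g : hom B A) :
  g \oc f = idm A -> f \oc g = idm B -> cls A = cls B.
Proof.
move=> gf fg; rewrite -[RHS]add0r -(cls_zero (zero_objectP abC)).
apply: (@cls_kernel _ _ _ 0 f); last first.
  by move=> X u v uv; rewrite -[u]compm1 -[v]compm1 -fg !compA uv.
apply: is_kernelP => [X u v _||X x fx0]; last 1 first.
- by exists 0; rewrite compm0 -[x]comp1m -gf -compA fx0 compm0.
- by apply: zero_object_homr; exact: zero_objectP.
- by rewrite compm0.
Qed.

Lemma cls_kernels A B K K' (f : hom A B) (k : hom K A) (k' : hom K' A) :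
  is_kernel f k -> is_kernel f k' -> cls K = cls K'.
Proof.
move=> kk kk'; have [u ku] := kernel_lift kk' kk.1.
have [u' ku'] := kernel_lift kk kk'.1.
apply: (@cls_iso _ _ u u').
  by apply: (kernel_monic kk); rewrite compA ku' ku compm1.
by apply: (kernel_monic kk'); rewrite compA ku ku' compm1.
Qed.

(** Both the image of [f] and the homology at [B] are quotients, of [A] by
    [ker f] and of [ker g] by the image. *)
Lemma cls_homology A B D Kf Kg (f : hom A B) (g : hom B D) (gf0 : g \oc f = 0)
    (kf : hom Kf A) (kg : hom Kg B) : is_kernel f kf -> is_kernel g kg ->
  cls (homology abC gf0) = cls Kg + cls Kf - cls A.
Proof.
move=> kkf kkg; rewrite /homology.
case: (cid _) => H /= [K [k [u [q [kk ku qq]]]]].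
rewrite (cls_kernels kkg kk).
have kku : is_kernel u kf.
  by apply/(is_kernel_monic_comp _ kf (kernel_monic kk)); rewrite ku.
have [I [e ee]] := ab_cokernels abC kf.
have [m [me _]] := ee.2 _ u kku.1.
have mm : monic m by apply: (monic_of_coimage abC kku ee); rewrite me.
have kke : is_kernel e kf.
  by apply/(is_kernel_monic_comp _ kf mm); rewrite me.
rewrite (cls_kernel kke (cokernel_epic ee)).
have qm : is_cokernel m q.
  by apply: (is_cokernel_epic_factor (cokernel_epic ee)); rewrite me.
rewrite (cls_kernel (monic_kernel_cokernel abC mm qm) (cokernel_epic qq)).
rewrite -[cls I + cls H + cls Kf]addrA [cls H + _]addrC addrA.
by rewrite [cls I + _]addrC [RHS]addrC addKr.
Qed.

End Grothendieck.
Lemma choice_dep (I : Type) (T : I -> Type) (R : forall i, T i -> Prop) :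
  (forall i, exists t, R i t) -> exists f, forall i, R i (f i).
Proof.
move=> ex; exists (fun i => projT1 (cid (ex i))) => i.
exact: projT2 (cid (ex i)).
Qed.

(** * Injective resolutions and their cosyzygies *)

Section Resolutions.
Variables (C : preaddCat) (abC : abelian C).

Lemma injective_resolution_exists (enoughC : enough_injectives C) (X : C) :
  exists J : coaug X, is_injective_resolution J.
Proof.
have hull_exists (Y : C) :
    exists h : {J : C & (hom Y J * {Y' : C & hom J Y'})%type},
    [/\ injective_object (projT1 h), monic (projT2 h).1
      & is_cokernel (projT2 h).1 (projT2 (projT2 h).2)].
  have [J [m [injJ mm]]] := enoughC Y.
  have [Y' [q qq]] := ab_cokernels abC m.
  by exists (existT _ J (m, existT _ Y' q)).
have [hull hullP] := choice_dep hull_exists.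
pose I Y := projT1 (hull Y); pose m Y : hom Y (I Y) := (projT2 (hull Y)).1.
pose X' Y := projT1 (projT2 (hull Y)).2.
pose q Y : hom (I Y) (X' Y) := projT2 (projT2 (hull Y)).2.
have {}hullP Y : [/\ injective_object (I Y), monic (m Y)
    & is_cokernel (m Y) (q Y)] := hullP Y.
clearbody I m X' q.
pose Z n := iter n X' X.
pose d n : hom (I (Z n)) (I (Z n.+1)) := m (Z n.+1) \oc q (Z n).
have dd n : d n.+1 \oc d n = 0.
  rewrite /d -compA (compA (q _)).
  by have [_ _ [-> _]] := hullP (Z n.+1); rewrite comp0m compm0.
have exact_d n Y (u : hom Y (Z n)) : epic u -> exact_at (m (Z n) \oc u) (d n).
  move=> eu; exists (Z n), u, (m (Z n)); split=> //.
  have [_ mm _] := hullP (Z n.+1); apply/(is_kernel_monic_comp _ _ mm).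
  by have [_ m' q'] := hullP (Z n); exact: monic_kernel_cokernel.
exists (@Coaug C X (@Cochain C (fun n => I (Z n)) d dd) (m X)); split=> [n|||n].
- by have [] := hullP (Z n).
- by have [] := hullP X.
- by rewrite -[coaug_map _]compm1; apply: (exact_d 0); exact: epic_id.
- by apply: exact_d; have [_ _ /cokernel_epic] := hullP (Z n).
Qed.

(** An injective resolution splices together the short exact sequences
    [0 -> Z n -> J n -> Z n.+1 -> 0] of its cosyzygies. *)
Lemma cosyzygies (X : C) (J : coaug X) : is_injective_resolution J ->
  exists (Z : nat -> C) (k : forall n, hom (Z n) (J n))
    (e : forall n, hom (J n) (Z n.+1)),
  [/\ Z 0 = X, forall n, is_kernel (e n) (k n), forall n, epic (e n)
    & forall n, codiff J n = k n.+1 \oc e n].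
Proof.
case=> _ maug ex0 exS.
have img_exists n :
    exists h : {I : C & (hom (J n) I * hom I (J n.+1))%type},
    [/\ epic (projT2 h).1, is_kernel (codiff J n.+1) (projT2 h).2
      & codiff J n = (projT2 h).2 \oc (projT2 h).1].
  by have [I [e [k ekP]]] := exS n; exists (existT _ I (e, k)).
have [img imgP] := choice_dep img_exists.
pose W n := projT1 (img n); pose e n : hom (J n) (W n) := (projT2 (img n)).1.
pose k n : hom (W n) (J n.+1) := (projT2 (img n)).2.
have {imgP} ekP n : [/\ epic (e n), is_kernel (codiff J n.+1) (k n)
    & codiff J n = k n \oc e n] := imgP n.
clearbody W e k.
exists (fun n => if n is n'.+1 then W n' else X),
  (fun n => match n return hom (if n is n'.+1 then W n' else X) (J n) with
            | 0 => coaug_map J | n'.+1 => k n' end), e.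
split=> // [n|n|n]; try by have [] := ekP n.
have [_ /kernel_monic mk dke] := ekP n.
apply/(is_kernel_monic_comp _ _ mk); rewrite -dke.
case: n {mk dke} => [|n]; last by have [] := ekP n.
have [I [u [i [eu ii augE]]]] := ex0.
have mu : monic u by move=> T v w uvw; apply: maug; rewrite augE -!compA uvw.
have [h uh] := monic_epic_section abC mu eu.
apply: is_kernelP => [//||T x /(kernel_lift ii)[y <-]].
  by rewrite augE compA ii.1 comp0m.
by exists (h \oc y); rewrite augE -compA (compA u) uh comp1m.
Qed.

End Resolutions.
(** * Modules that are constant on an interval-closed set *)

Section ConstantModules.
Variables (disp : Order.disp_t) (P : porderType disp).
Variables (C : preaddCat) (abC : abelian C).
Implicit Types (s t : bool) (S : pred P) (X Y M : pmodule P C) (T : C).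
Implicit Types a b c d : P.

Local Notation PC := (pmodCat P C).

Definition interval_closed S :=
  forall a b c, (a <= b)%O -> (b <= c)%O -> S a -> S c -> S b.

Definition const_ob T (s : bool) : C := if s then T else zero_object abC.

Definition const_map T (s t : bool) : hom (const_ob T s) (const_ob T t) :=
  match s, t with
  | true, true => idm T
  | _, _ => 0
  end.

Definition const_in T (s : bool) : hom T (const_ob T s) :=
  if s is true then idm T else 0.

Definition const_out T (s : bool) : hom (const_ob T s) T :=
  if s is true then idm T else 0.

Lemma const_outK T s : const_in T s \oc const_out T s = idm (const_ob T s).
Proof.
case: s; rewrite /= ?comp1m //.
by apply: zero_object_homl; exact: zero_objectP.
Qed.

Lemma const_inK T s : s -> const_out T s \oc const_in T s = idm T.
Proof. by case: s => // _; rewrite /= comp1m. Qed.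

Lemma const_ob_zero T s : ~~ s -> is_zero_object (const_ob T s).
Proof. by case: s => // _; exact: zero_objectP. Qed.

Lemma const_mapE T s t :
  const_map T s t = const_in T t \oc const_out T s.
Proof. by case: s t => [] []; rewrite /= ?comp1m ?comp0m ?compm0. Qed.

Lemma const_on_id T S a :
  const_map T (S a) (S a) = idm (const_ob T (S a)).
Proof. by rewrite const_mapE const_outK. Qed.

Lemma const_on_comp T S : interval_closed S -> forall a b c,
  (a <= b)%O -> (b <= c)%O ->
  const_map T (S a) (S c) = const_map T (S b) (S c) \oc const_map T (S a) (S b).
Proof.
move=> convS a b c ab bc; have := convS a b c ab bc.
case: (S a) (S b) (S c) => [] [] [] //=; rewrite ?comp1m ?comp0m ?compm0 //.
by move=> /(_ isT isT).
Qed.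

Definition const_on T S (convS : interval_closed S) : pmodule P C :=
  @PModule _ P C (fun a => const_ob T (S a))
    (fun a b _ => const_map T (S a) (S b)) (const_on_id T S)
    (fun a b c ab bc => const_on_comp T convS ab bc).

(** A morphism from [const_on T S] to [X] is a family of generalized elements
    of [X] over [S]; an arrow of [X] that leaves [S] must kill it, since
    [const_on T S] vanishes outside [S]. Extending the family by zero makes this
    and compatibility inside [S] a single equation. *)
Definition is_section S X T (x : forall c, hom T (X c)) :=
  (forall c, ~~ S c -> x c = 0) /\
  forall c d (cd : (c <= d)%O), S c -> pmmap X cd \oc x c = x d.

Lemma section_pmhom T S (convS : interval_closed S) X
    (x : forall c, hom T (X c)) : is_section S x ->
  exists s : pmhom (const_on T convS) X,
    forall c, s c = x c \oc const_out T (S c).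
Proof.
move=> [x0 xS].
have nat_x a b (ab : (a <= b)%O) : (x b \oc const_out T (S b)) \oc
    pmmap (const_on T convS) ab = pmmap X ab \oc (x a \oc const_out T (S a)).
  rewrite /= const_mapE -compA (compA (const_out T (S b))).
  have [Sa|nSa] := boolP (S a); last first.
    apply: zero_object_homl; exact: const_ob_zero.
  rewrite (compA (pmmap X ab)) xS //; have [Sb|nSb] := boolP (S b).
    by rewrite const_inK // comp1m.
  by rewrite x0 // !comp0m.
by exists (PMHom nat_x).
Qed.

Lemma pmhom_section T S (convS : interval_closed S) X
    (s : pmhom (const_on T convS) X) :
  is_section S (fun c => s c \oc const_in T (S c)).
Proof.
split=> [c nSc|c d cd Sc].
  have -> : const_in T (S c) = 0.
    by apply: zero_object_homr; exact: const_ob_zero.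
  by rewrite compm0.
rewrite compA -pmnat -compA /= const_mapE -compA const_inK //.
by rewrite compm1.
Qed.

Lemma ge_interval_closed b : interval_closed (fun c => b <= c)%O.
Proof. by move=> a c d ac _ ba _; exact: le_trans ba ac. Qed.

Lemma le_interval_closed b : interval_closed (fun c => c <= b)%O.
Proof. by move=> a c d _ cd _; exact: le_trans. Qed.

Lemma gt_interval_closed b : interval_closed (fun c => b < c)%O.
Proof. by move=> a c d ac _ ba _; exact: lt_le_trans ba ac. Qed.

(** Total in [a] and [b], so that families of maps out of [M a], or into [M b],
    can be written without case analysis on the order. *)
Definition extmap M a b : hom (M a) (M b) :=
  if @idP (a <= b)%O is ReflectT ab then pmmap M ab else 0.

Lemma extmapE M a b (ab : (a <= b)%O) : extmap M a b = pmmap M ab.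
Proof.
rewrite /extmap; case: {-}_ / idP => [ab'|//].
by congr pmmap; exact: bool_irrelevance.
Qed.

Lemma extmap_nle M a b : ~~ (a <= b)%O -> extmap M a b = 0.
Proof. by rewrite /extmap; case: {-}_ / idP => // ab; rewrite ab. Qed.

Lemma extmap_id M a : extmap M a a = idm (M a).
Proof. by rewrite (extmapE _ (lexx a)) pmmap_id. Qed.

Lemma extmap_nat X Y (f : pmhom X Y) a b :
  f b \oc extmap X a b = extmap Y a b \oc f a.
Proof.
have [ab|nab] := boolP (a <= b)%O; first by rewrite !(extmapE _ ab) pmnat.
by rewrite !extmap_nle // compm0 comp0m.
Qed.

(** [const_on T (>= b)] is free: its morphisms to [X] are the generalized
    elements [T -> X b]. *)
Lemma free_pmhom T b X (x : hom T (X b)) :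
  exists s : pmhom (const_on T (@ge_interval_closed b)) X,
    forall c, s c = extmap X b c \oc x \oc const_out T (b <= c)%O.
Proof.
apply: section_pmhom; split=> [c nbc|c d cd bc].
  by rewrite extmap_nle // comp0m.
by rewrite (extmapE _ bc) (extmapE _ (le_trans bc cd)) pmmap_comp compA.
Qed.

(** Dually, [const_on T (<= b)] is cofree. *)
Lemma cofree_pmhom T b X (x : hom (X b) T) :
  exists s : pmhom X (const_on T (@le_interval_closed b)),
    forall c, s c = const_in T (c <= b)%O \oc (x \oc extmap X c b).
Proof.
have nat_x a c (ac : (a <= c)%O) :
    (const_in T (c <= b)%O \oc (x \oc extmap X c b)) \oc pmmap X ac =
    pmmap (const_on T (@le_interval_closed b)) ac \oc
    (const_in T (a <= b)%O \oc (x \oc extmap X a b)).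
  rewrite /= const_mapE; have [cb|ncb] := boolP (c <= b)%O; last first.
    by apply: zero_object_homr; exact: const_ob_zero.
  have ab := le_trans ac cb.
  rewrite -!compA (compA (const_out _ _)) const_inK // comp1m.
  rewrite (extmapE _ cb) (extmapE _ ab) -pmmap_comp.
  by rewrite (bool_irrelevance ab (le_trans ac cb)).
by exists (@PMHom _ _ _ X (const_on T (@le_interval_closed b)) _ nat_x).
Qed.

(** * The abelian category of modules over a poset *)

Lemma pmhom_congr X Y (s t : pmhom X Y) : s = t -> forall c, s c = t c.
Proof. by move=> ->. Qed.

Lemma pmod_monicP X Y (m : pmhom X Y) :
  monic (C := PC) m <-> forall c, monic (m c).
Proof.
split=> [mm c T u v muv|mm W s t st].
  have [su suE] := free_pmhom u; have [sv svE] := free_pmhom v.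
  have suv : su = sv.
    apply: (mm (const_on T (@ge_interval_closed c))).
    apply: pmhom_eq => d /=.
    by rewrite suE svE !compA !extmap_nat -!(compA _ (m c)) muv.
  rewrite -[u]comp1m -[v]comp1m -!(extmap_id X c).
  have := pmhom_congr suv c; rewrite suE svE.
  move/(congr1 (comp^~ (const_in T _))).
  by rewrite -!(compA _ (const_out _ _)) const_inK ?lexx // !compm1.
apply: pmhom_eq => c; apply: mm; exact: pmhom_congr st c.
Qed.

Lemma pmod_epicP X Y (e : pmhom X Y) :
  epic (C := PC) e <-> forall c, epic (e c).
Proof.
split=> [ee c T u v euv|ee W s t st].
  have [su suE] := cofree_pmhom u; have [sv svE] := cofree_pmhom v.
  have suv : su = sv.
    apply: (ee (const_on T (@le_interval_closed c))).
    apply: pmhom_eq => d /=.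
    by rewrite suE svE -!compA -!extmap_nat !(compA u) !(compA v) euv.
  rewrite -[u]compm1 -[v]compm1 -!(extmap_id Y c).
  have := pmhom_congr suv c; rewrite suE svE.
  move/(congr1 (comp (const_out T _))).
  by rewrite !(compA (const_out _ _)) const_inK ?lexx // !comp1m.
apply: pmhom_eq => c; apply: ee; exact: pmhom_congr st c.
Qed.

Lemma pmod_kernelP X Y K (f : pmhom X Y) (k : pmhom K X) :
  is_kernel (C := PC) f k <-> forall c, is_kernel (f c) (k c).
Proof.
split=> [kk c|kk].
  apply: is_kernelP => [||T x fx0].
  - exact: (pmod_monicP k).1 (kernel_monic kk) c.
  - exact: pmhom_congr kk.1 c.
  have [s sE] := free_pmhom x.
  have fs0 : comp (p := PC) f s = 0.
    apply: pmhom_eq => d /=.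
    by rewrite sE !compA extmap_nat -(compA _ (f c)) fx0 compm0 comp0m.
  have [u ku] := kernel_lift kk fs0.
  exists ((u : pmhom _ _) c \oc const_in T _).
  have /= := pmhom_congr ku c; rewrite compA => ->.
  by rewrite sE -compA const_inK ?lexx // extmap_id comp1m compm1.
apply: (is_kernelP (C := PC)) => [||W x fx0].
- by apply/pmod_monicP => c; exact: kernel_monic (kk c).
- by apply: pmhom_eq => c; exact: (kk c).1.
have [u ku] := choice_dep (fun c => kernel_lift (kk c) (pmhom_congr fx0 c)).
have nat_u a b (ab : (a <= b)%O) : u b \oc pmmap W ab = pmmap K ab \oc u a.
  apply: (kernel_monic (kk b)).
  by rewrite !compA ku !pmnat -compA ku.
by exists (PMHom nat_u); apply: pmhom_eq => c; exact: ku.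
Qed.

Lemma pmod_cokernel X Y Q (f : pmhom X Y) (q : pmhom Y Q) :
  (forall c, is_cokernel (f c) (q c)) -> is_cokernel (C := PC) f q.
Proof.
move=> qq; apply: (is_cokernelP (C := PC)) => [||W x xf0].
- by apply/pmod_epicP => c; exact: cokernel_epic (qq c).
- by apply: pmhom_eq => c; exact: (qq c).1.
have lift c : exists u, u \oc q c = (x : pmhom _ _) c.
  have [u [uq _]] := (qq c).2 _ _ (pmhom_congr xf0 c); by exists u.
have [u uq] := choice_dep lift.
have nat_u a b (ab : (a <= b)%O) : u b \oc pmmap Q ab = pmmap W ab \oc u a.
  apply: (cokernel_epic (qq a)).
  by rewrite -!compA uq -!pmnat compA uq.
by exists (PMHom nat_u); apply: pmhom_eq => c; exact: uq.
Qed.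

Lemma pmod_kernels X Y (f : pmhom X Y) : exists K (k : pmhom K X),
  forall c, is_kernel (f c) (k c).
Proof.
have [K exK] := choice_dep (fun c => ab_kernels abC (f c)).
have [k kk] := choice_dep exK.
have mk c := kernel_monic (kk c).
have fk0 a b (ab : (a <= b)%O) : f b \oc (pmmap X ab \oc k a) = 0.
  by rewrite compA pmnat -compA (kk a).1 compm0.
pose Kmap a b ab := projT1 (cid (kernel_lift (kk b) (@fk0 a b ab))).
have kK a b (ab : (a <= b)%O) : k b \oc Kmap a b ab = pmmap X ab \oc k a.
  exact: projT2 (cid (kernel_lift (kk b) (@fk0 a b ab))).
clearbody Kmap.
have K1 a : Kmap a a (lexx a) = idm (K a).
  by apply: mk; rewrite kK pmmap_id comp1m compm1.
have KM a b c (ab : (a <= b)%O) (bc : (b <= c)%O) :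
    Kmap a c (le_trans ab bc) = Kmap b c bc \oc Kmap a b ab.
  by apply: mk; rewrite kK compA kK -compA kK compA pmmap_comp.
by exists (PModule K1 KM), (@PMHom _ _ _ (PModule K1 KM) X k kK).
Qed.

Lemma pmod_cokernels X Y (f : pmhom X Y) : exists Q (q : pmhom Y Q),
  forall c, is_cokernel (f c) (q c).
Proof.
have [Q exQ] := choice_dep (fun c => ab_cokernels abC (f c)).
have [q qq] := choice_dep exQ.
have eq c := cokernel_epic (qq c).
have desc a b (ab : (a <= b)%O) :
    exists u, u \oc q a = q b \oc pmmap Y ab.
  have [|u [uq _]] := (qq a).2 _ (q b \oc pmmap Y ab); last by exists u.
  by rewrite -compA -pmnat compA (qq b).1 comp0m.
pose Qmap a b ab := projT1 (cid (@desc a b ab)).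
have Qq a b (ab : (a <= b)%O) : Qmap a b ab \oc q a = q b \oc pmmap Y ab.
  exact: projT2 (cid (@desc a b ab)).
clearbody Qmap.
have Q1 a : Qmap a a (lexx a) = idm (Q a).
  by apply: eq; rewrite Qq pmmap_id comp1m compm1.
have QM a b c (ab : (a <= b)%O) (bc : (b <= c)%O) :
    Qmap a c (le_trans ab bc) = Qmap b c bc \oc Qmap a b ab.
  by apply: eq; rewrite Qq -compA Qq compA Qq -compA pmmap_comp.
exists (PModule Q1 QM).
by exists (@PMHom _ _ _ Y (PModule Q1 QM) q (fun a b ab => esym (Qq a b ab))).
Qed.

Lemma pmhom_sum (I : finType) X Y (s : I -> pmhom X Y) c :
  (\sum_i s i : pmhom X Y) c = \sum_i s i c.
Proof. exact: (big_morph (fun s : pmhom X Y => s c)). Qed.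

Lemma pmod_biproducts (I : finType) (A : I -> pmodule P C) :
  exists B inj proj, @is_biproduct PC I A B inj proj.
Proof.
have [B exB] := choice_dep (fun c => ab_biproducts abC (fun i => A i c)).
have [inj exinj] := choice_dep exB.
have [pr bipP] := choice_dep exinj.
pose Bmap a b (ab : (a <= b)%O) : hom (B a) (B b) :=
  \sum_i inj b i \oc pmmap (A i) ab \oc pr a i.
have prB a b (ab : (a <= b)%O) i :
    pr b i \oc Bmap a b ab = pmmap (A i) ab \oc pr a i.
  have [p1 p0 _] := bipP b; rewrite comp_sumr (bigD1 i) //= big1 => [|j ji].
    by rewrite addr0 !compA p1 comp1m.
  by rewrite !compA p0 // !comp0m.
have Binj a b (ab : (a <= b)%O) i :
    Bmap a b ab \oc inj a i = inj b i \oc pmmap (A i) ab.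
  have [p1 p0 _] := bipP a; rewrite comp_suml (bigD1 i) //= big1 => [|j ji].
    by rewrite addr0 -!compA p1 compm1.
  by rewrite -!compA p0 1?eq_sym // !compm0.
have pr_ext c T (u v : hom T (B c)) :
    (forall i, pr c i \oc u = pr c i \oc v) -> u = v.
  move=> uv; have [_ _ s1] := bipP c; rewrite -[u]comp1m -[v]comp1m -s1.
  by rewrite !comp_suml; apply: eq_bigr => i _; rewrite -!compA uv.
have B1 a : Bmap a a (lexx a) = idm (B a).
  by apply: pr_ext => i; rewrite prB pmmap_id comp1m compm1.
have BM a b c (ab : (a <= b)%O) (bc : (b <= c)%O) :
    Bmap a c (le_trans ab bc) = Bmap b c bc \oc Bmap a b ab.
  by apply: pr_ext => i; rewrite prB compA prB -compA prB compA pmmap_comp.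
pose BB := PModule B1 BM.
pose injB i : pmhom (A i) BB := @PMHom _ _ _ (A i) BB (fun c => inj c i)
  (fun a b ab => esym (Binj a b ab i)).
pose prB' i : pmhom BB (A i) := @PMHom _ _ _ BB (A i) (fun c => pr c i)
  (fun a b ab => prB a b ab i).
exists BB, injB, prB'; split=> [i|i j ij|].
- by apply: pmhom_eq => c; have [p1 _ _] := bipP c; exact: p1.
- by apply: pmhom_eq => c; have [_ p0 _] := bipP c; exact: p0.
- apply: pmhom_eq => c; rewrite pmhom_sum.
  by have [_ _ s1] := bipP c; exact: s1.
Qed.

Lemma pmod_abelian : abelian PC.
Proof.
split.
- exact: pmod_biproducts.
- move=> X Y f; have [K [k kk]] := pmod_kernels f; exists K, k.
  exact/pmod_kernelP.
- move=> X Y f; have [Q [q qq]] := pmod_cokernels f; exists Q, q.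
  exact: pmod_cokernel.
- move=> X Y m /pmod_monicP mm; have [Q [q qq]] := pmod_cokernels m.
  exists Q, q; apply/pmod_kernelP => c; exact: monic_kernel_cokernel.
- move=> X Y e /pmod_epicP ee; have [K [k kk]] := pmod_kernels e.
  exists K, k; apply: pmod_cokernel => c; exact: epic_cokernel_kernel.
Qed.

Lemma cofree_injective I b : injective_object I ->
  injective_object (C := PC) (const_on I (@le_interval_closed b)).
Proof.
move=> injI X Y m w /pmod_monicP mm.
pose wb : hom (X b) I := const_out I (b <= b)%O \oc (w : pmhom _ _) b.
have [v vm] := injI _ _ _ wb (mm b).
have [s sE] := cofree_pmhom v; exists s; apply: pmhom_eq => c /=; rewrite sE.
case: (orP (orbN (c <= b)%O)) => [cb|ncb]; last first.
  by apply: zero_object_homr; exact: const_ob_zero.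
rewrite -!compA -extmap_nat (compA v) vm /wb (extmapE _ cb) -compA.
rewrite (pmnat (w : pmhom _ _) cb) /= const_mapE !compA.
by rewrite -(compA (const_in _ _)) const_inK ?lexx // compm1 const_outK comp1m.
Qed.

End ConstantModules.

Section EnoughInjectives.
Variables (disp : Order.disp_t) (P : finPOrderType disp).
Variables (C : preaddCat) (abC : abelian C).

(** The module [X] embeds in the product over [b] of the cofree modules on
    injective hulls of the [X b]. *)
Lemma pmod_enough_injectives :
  enough_injectives C -> enough_injectives (pmodCat P C).
Proof.
move=> enC X.
have [I exI] := choice_dep (fun b => enC ((X : pmodule P C) b)).
have [i iP] := choice_dep exI.
pose E b : pmodCat P C := const_on abC (I b) (@le_interval_closed _ P b).
have [B [inj [pr [p1 p0 s1]]]] := ab_biproducts (pmod_abelian P abC) E.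
have [j jE] := choice_dep (fun b => cofree_pmhom abC (i b)).
exists B, (\sum_b inj b \oc j b); split.
  move=> M N m u mm.
  have ext b : exists v, v \oc m = pr b \oc u.
    by apply: (cofree_injective (iP b).1).
  have [v vm] := choice_dep ext.
  exists (\sum_b inj b \oc v b).
  rewrite comp_suml -[u]comp1m -s1 comp_suml; apply: eq_bigr => b _.
  by rewrite -!compA vm.
have pj b : pr b \oc (\sum_c inj c \oc j c) = j b.
  rewrite comp_sumr (bigD1 b) // compA p1 comp1m.
  rewrite big1 => [|c cb]; first exact: addr0.
  by rewrite compA p0 // comp0m.
move=> M s t st; apply: pmhom_eq => c; apply: (iP c).2.
have jst : comp (j c : hom X (E c)) s = comp (j c : hom X (E c)) t.
  by rewrite -pj -!compA st.
have := pmhom_congr jst c; rewrite /= jE.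
move/(congr1 (comp (const_out abC (I c) (c <= c)%O))).
by rewrite !compA const_inK ?lexx // comp1m extmap_id compm1.
Qed.

End EnoughInjectives.
(** * Moebius inversion *)

Section MoebiusInversion.
Variables (disp : Order.disp_t) (P : finPOrderType disp) (V : zmodType).
Implicit Types (m e : P -> V) (a b c : P).

Lemma mobiusP : is_mobius (@mobius _ P).
Proof. exact: projT2 (cid (@mobius_exists _ P)). Qed.

Lemma mobius_inversion_sum m e :
  (forall a, m a = \sum_(b | (a <= b)%O) e b) ->
  forall a, mobius_inversion m a = e a.
Proof.
move=> me a; rewrite /mobius_inversion.
transitivity (\sum_(b | (a <= b)%O) \sum_(c | (b <= c)%O) e c *~ mobius a b).
  by apply: eq_bigr => b _; rewrite me mulrz_suml.
rewrite (exchange_big_dep (fun c => (a <= c)%O)) /=; last first.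
  by move=> b c; exact: le_trans.
rewrite (bigD1 a) ?lexx //= [X in _ + X]big1 ?addr0 => [|c /andP[ac ca]].
  rewrite (big_pred1 a) => [|b]; last by rewrite -eq_le eq_sym.
  have [+ _] := mobiusP (lexx a); rewrite /convol /delta eqxx.
  rewrite (big_pred1 a) => [|b]; last by rewrite -eq_le eq_sym.
  by rewrite mulr1 => ->; rewrite mulr1z.
have [+ _] := mobiusP ac; rewrite /convol /delta eq_sym (negPf ca).
rewrite (eq_bigr (mobius a)) => [mu0|b _]; last exact: mulr1.
by rewrite -mulrz_sumr mu0 mulr0z.
Qed.

Lemma sum_mobius_inversion m a :
  \sum_(b | (a <= b)%O) mobius_inversion m b = m a.
Proof.
rewrite (exchange_big_dep (fun c => (a <= c)%O)) /=; last first.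
  by move=> b c; exact: le_trans.
have sum_mu c : (a <= c)%O ->
    \sum_(b | (a <= b)%O && (b <= c)%O) m c *~ mobius b c =
    m c *~ delta a c.
  move=> ac; have [_ <-] := mobiusP ac; rewrite -mulrz_sumr.
  by congr (_ *~ _); apply: eq_bigr => b _; rewrite mul1r.
rewrite (bigD1 a) ?lexx //= sum_mu // big1 => [|c /andP[ac ca]].
  by rewrite addr0 /delta eqxx mulr1z.
by rewrite sum_mu // /delta eq_sym (negPf ca) mulr0z.
Qed.

End MoebiusInversion.

(** Summed over all [b >= a], the right-hand side collects the Moebius inverse
    of [n] over the [x] with [a <= g x], that is with [f a <= x]; the total is
    [n (f a)], and Moebius inversion on [P] recovers the summands. *)
Lemma mobius_inversion_galois (dP dQ : Order.disp_t) (P : finPOrderType dP)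
    (Q : finPOrderType dQ) (V : zmodType) (f : P -> Q) (g : Q -> P)
    (fg : galois_connection f g) (n : Q -> V) (a : P) :
  mobius_inversion (fun_pullback f n) a =
  fun_pushforward g (mobius_inversion n) a.
Proof.
apply: mobius_inversion_sum => {}a.
rewrite /fun_pullback -[LHS]sum_mobius_inversion /fun_pushforward.
rewrite [RHS](exchange_big_dep predT) //= [LHS]big_mkcond /=.
apply: eq_bigr => x _.
rewrite (galois_adj fg); have [agx|nagx] := ifPn.
  rewrite (big_pred1 (g x)) // => b; rewrite /= [RHS]eq_sym.
  by case: eqP => [<-|]; rewrite ?agx ?andbF.
by rewrite big1 // => b /andP[ab /eqP gxb]; rewrite -gxb (negPf nagx) in ab.
Qed.

(** * Flabby modules *)

Section Flabby.
Variables (disp : Order.disp_t) (P : finPOrderType disp).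
Variables (C : preaddCat) (abC : abelian C).
Implicit Types (S : pred P) (X J : pmodule P C) (T : C) (a b c d : P).

Lemma minimal_exists S : (exists b, S b) ->
  exists b, S b /\ forall c, S c -> ~~ (c < b)%O.
Proof.
case=> b0 Sb0.
have [b Sb bmin] := arg_minnP (fun b => #|[pred c | (c < b)%O]|) Sb0.
exists b; split=> // c Sc; apply/negP => cb; have := bmin c Sc.
rewrite leqNgt => /negP; apply; apply: proper_card; apply/properP; split.
  by apply/fintype.subsetP => d; rewrite !inE => dc; exact: lt_trans cb.
by exists c; rewrite !inE ?ltxx.
Qed.

Lemma remove_minimal_ind (K : pred P -> Prop) :
  (forall S, (forall c, ~~ S c) -> K S) ->
  (forall S b, S b -> (forall c, S c -> ~~ (c < b)%O) ->
     K (fun c => S c && (c != b)) -> K S) ->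
  forall S, K S.
Proof.
move=> K0 Kb S; have [n] := ubnP #|S|; elim: n S => // n IH S Sn.
have [/minimal_exists[b [Sb bmin]]|S0] := pselect (exists b, S b).
  apply: (Kb S b Sb bmin); apply: IH; rewrite -ltnS; apply: leq_trans Sn.
  rewrite ltnS; apply: proper_card; apply/properP; split.
    by apply/fintype.subsetP => c /andP[].
  by exists b; rewrite // unfold_in eqxx andbF.
by apply: K0 => c; apply/negP => Sc; apply: S0; exists c.
Qed.

(** In sheaf terms, restriction of sections from the smallest open set around
    [b] to that set without [b] is an epimorphism. *)
Definition flabby_at X b :=
  forall T (x : forall c, hom T (X c)), is_section (fun c => b < c)%O x ->
  exists T' (t : hom T' T) (y : hom T' (X b)), epic t /\
    forall c (bc : (b < c)%O), pmmap X (ltW bc) \oc y = x c \oc t.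

(** A section over the elements above [b] is a morphism from a submodule of a
    free module at [b]; it extends by injectivity. *)
Lemma injective_flabby J b :
  injective_object (C := pmodCat P C) J -> flabby_at J b.
Proof.
move=> injJ T x xS.
have [s sE] := section_pmhom abC (@gt_interval_closed _ P b) xS.
(* The inclusion of [const_on T (> b)] into [const_on T (>= b)]. *)
pose iota c := if (b < c)%O then const_in abC T (b <= c)%O else 0.
have iota_gt c : (b < c)%O -> iota c = const_in abC T (b <= c)%O.
  by rewrite /iota => ->.
have iotaS : is_section (X := const_on abC T (@ge_interval_closed _ P b))
    (fun c => b < c)%O iota.
  rewrite /iota; split=> [c /negPf-> //|c d cd bc].
  rewrite bc (lt_le_trans bc cd) /= const_mapE -compA const_inK ?compm1 //.
  exact: ltW.
have [i iE] := section_pmhom abC (@gt_interval_closed _ P b) iotaS.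
have mi : monic (C := pmodCat P C) i.
  apply/(pmod_monicP abC) => c; rewrite iE.
  case: (orP (orbN (b < c)%O)) => [bc|nbc]; last first.
    by move=> Z u v _; apply: zero_object_homr; exact: const_ob_zero.
  rewrite iota_gt // => Z u v.
  move/(congr1 (comp (const_in abC T (b < c)%O \oc const_out abC T _))).
  rewrite !compA -(compA (const_in abC T (b < c)%O)) const_inK ?(ltW bc) //.
  by rewrite compm1 const_outK !comp1m.
have [v vi] := injJ _ _ i s mi.
have [_ vS] := pmhom_section (v : pmhom _ _).
exists T, (idm T), ((v : pmhom _ _) b \oc const_in abC T (b <= b)%O).
split=> [|c bc]; first exact: epic_id.
rewrite vS ?lexx // compm1.
have := pmhom_congr vi c; rewrite /= iE sE iota_gt //.
move/(congr1 (comp^~ (const_in abC T _))).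
by rewrite -!compA const_inK ?bc // !compm1.
Qed.

Section ShortExact.
Variables (X J X' : pmodule P C) (k : pmhom X J) (e : pmhom J X').
Hypotheses (kk : forall c, is_kernel (e c) (k c)) (ee : forall c, epic (e c)).

(** Extend over one minimal element [b] of [S] at a time. A lift at [b] of the
    given section agrees with the lift already found above [b] up to a section
    of [X], which extends to [b] and corrects the choice. *)
Lemma section_lift S (upS : forall c d, (c <= d)%O -> S c -> S d) T
    (y : forall c, hom T (X' c)) :
  (forall b, S b -> flabby_at X b) -> is_section S y ->
  exists T' (t : hom T' T) (x : forall c, hom T' (J c)),
    [/\ epic t, is_section S x & forall c, e c \oc x c = y c \oc t].
Proof.
elim/remove_minimal_ind: S upS T y => [S S0|S b Sb bmin IH] upS T y flX yS.
  exists T, (idm T), (fun c => 0); split=> [||c]; first exact: epic_id.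
    by split=> // c d cd Sc; rewrite compm0.
  by rewrite compm0 yS.1 // comp0m.
have neq_b c d : (c <= d)%O -> S c -> c != b -> d != b.
  move=> cd Sc cb; apply/eqP => db; have := bmin c Sc.
  by rewrite lt_neqAle cb -db cd.
pose S' c := S c && (c != b).
pose y' c := if c == b then 0 else y c.
have upS' c d : (c <= d)%O -> S' c -> S' d.
  move=> cd /andP[Sc cb]; apply/andP; split; first exact: upS Sc.
  exact: neq_b cb.
have y'S : is_section S' y'.
  rewrite /y' /S'; split=> [c|c d cd /andP[Sc cb]].
    by case: eqP => [//|_]; rewrite andbT => /yS.1.
  by rewrite (negPf cb) (negPf (neq_b _ _ cd Sc cb)); exact: yS.2.
have [|T1 [t1 [x1 [et1 x1S ex1]]]] := IH upS' T y' _ y'S.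
  by move=> c /andP[Sc _]; exact: flX.
have [T2 [t2 [xb [et2 exb]]]] := epic_lift abC (y b \oc t1) (@ee b).
have S'gt c : (b < c)%O -> S' c.
  by move=> bc; rewrite /S' (upS b c (ltW bc) Sb) (gt_eqF bc).
(* [xb] and [x1] lift the same section of [X'], so above [b] they differ by a
   section [z] of the kernel [X]. *)
have diff c : exists z : hom T2 (X c), k c \oc z =
    if (b < c)%O then extmap J b c \oc xb - x1 c \oc t2 else 0.
  apply: (kernel_lift (kk c)); case: ifP => [bc|_]; last exact: compm0.
  rewrite compDr compmN !compA extmap_nat ex1 -(compA _ (e b)) exb.
  rewrite (extmapE _ (ltW bc)) !compA yS.2 // /y' gt_eqF //.
  by rewrite subrr.
have [z kz] := choice_dep diff.
have mk c := kernel_monic (kk c).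
have zS : is_section (fun c => b < c)%O z.
  split=> [c nbc|c d cd /= bc].
    by apply: (monic0 (mk c)); rewrite kz (negPf nbc).
  have bd := lt_le_trans bc cd.
  apply: mk; rewrite compA pmnat -compA !kz bc bd compDr compmN !compA.
  rewrite (x1S.2 c d cd (S'gt c bc)) (extmapE _ (ltW bc)) (extmapE _ (ltW bd)).
  by rewrite -pmmap_comp (bool_irrelevance (le_trans _ _) (ltW bd)).
have [T3 [t3 [w [et3 wz]]]] := flX b Sb _ z zS.
pose v := xb \oc t3 - k b \oc w.
pose x c := if c == b then extmap J b c \oc v else x1 c \oc t2 \oc t3.
have x_ge c : (b <= c)%O -> x c = extmap J b c \oc v.
  rewrite /x; case: eqP => [//|/eqP cb] bc.
  have {cb} bc' : (b < c)%O by rewrite lt_neqAle eq_sym cb.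
  rewrite /v compDr compmN !compA -extmap_nat -(compA (k c)).
  rewrite (extmapE X (ltW bc')) wz compA kz bc' compDl compNm -!compA.
  by rewrite opprD opprK addrA subrr add0r.
exists T3, (t1 \oc t2 \oc t3), x; split.
- by apply: epic_comp => //; exact: epic_comp.
- split=> [c nSc|c d cd Sc].
    rewrite /x; have /negPf-> : c != b by apply/eqP => cb; rewrite cb Sb in nSc.
    by rewrite x1S.1 ?comp0m // /S' (negPf nSc).
  have [cb|cb] := eqVneq c b.
    have bc : (b <= c)%O by rewrite cb.
    have bd := le_trans bc cd.
    rewrite !x_ge // compA (extmapE _ bc) (extmapE _ bd) -pmmap_comp.
    by rewrite (bool_irrelevance (le_trans _ _) bd).
  rewrite /x (negPf cb) (negPf (neq_b _ _ cd Sc cb)) !compA x1S.2 //.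
  by rewrite /S' Sc.
move=> c; rewrite /x; case: eqP => [->|/eqP cb].
  by rewrite extmap_id comp1m compDr compmN !compA exb (@kk b).1 comp0m subr0.
by rewrite !compA ex1 /y' (negPf cb).
Qed.

(** A section of [X'] over the elements above [b] lifts to [J] since [X] is
    flabby on all of them, then extends to [b] in [J], and maps back to [X'].
    Bounding the number of elements above [b] is what makes the induction along
    a resolution terminate. *)
Lemma flabby_cokernel n : (forall b, flabby_at J b) ->
  (forall b, (#|[pred c | (b < c)%O]| < n)%N -> flabby_at X b) ->
  forall b, (#|[pred c | (b < c)%O]| < n.+1)%N -> flabby_at X' b.
Proof.
move=> flJ flX b bn T y yS.
have up c d : (c <= d)%O -> (b < c)%O -> (b < d)%O.
  by move=> cd bc; exact: lt_le_trans cd.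
have [|T1 [t1 [x [et1 xS ex]]]] := section_lift up _ yS.
  move=> c bc; apply: flX; rewrite -ltnS; apply: leq_trans bn; rewrite ltnS.
  apply: proper_card; apply/properP; split.
    by apply/fintype.subsetP => d; rewrite !inE; exact: lt_trans.
  by exists c; rewrite !inE ?ltxx.
have [T2 [t2 [v [et2 vx]]]] := flJ b T1 x xS.
exists T2, (t1 \oc t2), (e b \oc v); split=> [|c bc]; first exact: epic_comp.
by rewrite compA -pmnat -compA vx compA ex compA.
Qed.

End ShortExact.

(** * Objects of sections and their classes *)

Definition represents_sections S X F (p : forall c, hom F (X c)) :=
  [/\ is_section S p,
    forall T (x : forall c, hom T (X c)), is_section S x ->
      exists v, forall c, p c \oc v = x c
  & forall T (u v : hom T F), (forall c, p c \oc u = p c \oc v) -> u = v].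

(** When [X] is flabby at [b], the sections over [S] map onto those over
    [S] without [b], and the kernel is the sections over [b] alone. *)
Lemma cls_sections_remove X S b F Fb F' (p : forall c, hom F (X c))
    (pb : forall c, hom Fb (X c)) (p' : forall c, hom F' (X c)) :
  interval_closed S -> S b -> (forall c, S c -> ~~ (c < b)%O) ->
  flabby_at X b ->
  represents_sections S p -> represents_sections (pred1 b) pb ->
  represents_sections (fun c => S c && (c != b)) p' ->
  cls F = cls Fb + cls F'.
Proof.
move=> convS Sb bmin flX [pS pE pU] [pbS pbE pbU] [p'S p'E p'U].
have neq_b c d : (c <= d)%O -> S c -> c != b -> d != b.
  move=> cd Sc cb; apply/eqP => db; have := bmin c Sc.
  by rewrite lt_neqAle cb -db cd.
have [|q qE] := p'E F (fun c => if c == b then 0 else p c).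
  split=> [c|c d cd /andP[Sc cb]].
    by case: eqP => [//|_]; rewrite andbT => /pS.1.
  by rewrite (negPf cb) (negPf (neq_b _ _ cd Sc cb)); exact: pS.2.
have [|i iE] := pE Fb pb.
  split=> [c nSc|c d cd Sc].
    by apply: pbS.1; apply: contra nSc => /= /eqP->.
  have [cb|cb] := eqVneq c b; first by apply: pbS.2; rewrite /= cb.
  by rewrite (pbS.1 c cb) (pbS.1 d (neq_b _ _ cd Sc cb)) compm0.
apply: (cls_kernel abC (k := i) (e := q)).
  apply: is_kernelP => [T u v uv||T x qx0].
  - by apply: pbU => c; rewrite -!iE -!compA uv.
  - apply: p'U => c; rewrite compA qE compm0; case: eqP => [|/eqP cb].
      by rewrite comp0m.
    by rewrite iE; exact: pbS.1.
  have px0 c : c != b -> p c \oc x = 0.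
    move=> cb; have := congr1 (comp (p' c)) qx0.
    by rewrite compA qE (negPf cb) compm0.
  have [|u pu] := pbE T (fun c => p c \oc x).
    split=> [c /px0 //|c d cd /eqP cb].
    by rewrite compA pS.2 // cb.
  by exists u; apply: pU => c; rewrite compA iE pu.
have [|T [t [w [et wE]]]] := flX F' (fun c => if (b < c)%O then p' c else 0).
  split=> [c /negPf-> //|c d cd bc]; rewrite bc (lt_le_trans bc cd).
  have [Sc|nSc] := boolP (S c); first by rewrite p'S.2 // Sc (gt_eqF bc).
  rewrite !p'S.1 ?compm0 // ?(negPf nSc) // (gt_eqF (lt_le_trans bc cd)) andbT.
  by apply: contra nSc; exact: convS (ltW bc) cd Sb.
pose x c := if c == b then extmap X b c \oc w else p' c \oc t.
have xS : is_section S x.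
  rewrite /x; split=> [c nSc|c d cd Sc].
    have /negPf-> : c != b by apply/eqP => cb; rewrite cb Sb in nSc.
    by rewrite p'S.1 ?comp0m // (negPf nSc).
  have [cb|cb] := eqVneq c b; last first.
    by rewrite (negPf (neq_b _ _ cd Sc cb)) compA p'S.2 // Sc.
  have bc : (b <= c)%O by rewrite cb.
  have bd := le_trans bc cd.
  rewrite compA (extmapE _ bc) -pmmap_comp; case: eqP => [_|/eqP db].
    by rewrite (extmapE _ bd) (bool_irrelevance (le_trans _ _) bd).
  have {db} bd' : (b < d)%O by rewrite lt_neqAle eq_sym db.
  by rewrite (bool_irrelevance (le_trans _ _) (ltW bd')) wE bd'.
have [v vx] := pE T x xS.
apply: (@epic_factor _ _ _ _ _ v); suff -> : q \oc v = t by [].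
apply: p'U => c; rewrite compA qE; case: eqP => [->|/eqP cb].
  by rewrite p'S.1 ?comp0m // eqxx andbF.
by rewrite vx /x (negPf cb).
Qed.

Lemma cls_sections_empty X S F (p : forall c, hom F (X c)) :
  (forall c, ~~ S c) -> represents_sections S p -> cls F = 0.
Proof.
move=> S0 [pS _ pU]; apply: (cls_zero abC).
have id0 : idm F = 0.
  by apply: pU => c; rewrite pS.1 // !comp0m.
move=> Y; split=> u v.
  by rewrite -[u]compm1 -[v]compm1 id0 !compm0.
by rewrite -[u]comp1m -[v]comp1m id0 !comp0m.
Qed.

Lemma cls_sections_ge X a F (p : forall c, hom F (X c)) :
  represents_sections (fun c => a <= c)%O p -> cls F = cls (X a).
Proof.
move=> [pS pE pU]; have [|v vE] := pE (X a) (extmap X a).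
  split=> [c nac|c d cd ac]; first exact: extmap_nle.
  by rewrite (extmapE _ ac) (extmapE _ (le_trans ac cd)) pmmap_comp.
apply: (cls_iso abC (f := p a) (g := v)); last by rewrite vE extmap_id.
apply: pU => c; rewrite compA vE compm1.
have [ac|nac] := boolP (a <= c)%O; first by rewrite (extmapE _ ac) pS.2.
by rewrite extmap_nle // comp0m pS.1.
Qed.

(** Removing minimal elements one by one splits the class of an object of
    sections into contributions of single elements; over [S = (>= a)] these add
    up to the class of [X a], so they are the Moebius inverse of [X]. *)
Theorem cls_flabby_sections X S F (p : forall c, hom F (X c)) :
  (forall R : pred P, interval_closed R ->
     exists F (p : forall c, hom F (X c)), represents_sections R p) ->
  (forall b, flabby_at X b) ->
  interval_closed S -> represents_sections S p ->
  cls F = \sum_(b | S b) mobius_inversion (fun c => cls (X c)) b.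
Proof.
move=> ex flX.
have conv1 b : interval_closed (pred1 b).
  by move=> a c d ac cd /eqP ab /eqP db; rewrite /= eq_le -{1}db cd -ab ac.
have [E exE] := choice_dep (fun b => ex _ (conv1 b)).
have [pE EP] := choice_dep exE.
have clsE R G (r : forall c, hom G (X c)) : interval_closed R ->
    represents_sections R r -> cls G = \sum_(b | R b) cls (E b).
  elim/remove_minimal_ind: R G r => [R R0|R b Rb bmin IH] G r convR rP.
    rewrite (cls_sections_empty R0 rP) big_pred0 // => c; exact: negbTE (R0 c).
  have convR' : interval_closed (fun c => R c && (c != b)).
    move=> a c d ac cd /andP[Ra ab] /andP[Rd _].
    rewrite (convR a c d) //; apply/eqP => cb; have := bmin a Ra.
    by rewrite lt_neqAle ab -cb ac.
  have [G' [r' r'P]] := ex _ convR'.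
  rewrite (cls_sections_remove convR Rb bmin (flX b) rP (EP b) r'P).
  by rewrite (IH _ _ convR' r'P) [RHS](bigD1 b).
move=> convS pP; rewrite (clsE S F p convS pP); apply: eq_bigr => b _.
apply: esym; apply: (mobius_inversion_sum (e := fun b => cls (E b))) => {b}a.
have [G [r rP]] := ex _ (@ge_interval_closed _ P a).
by rewrite -(cls_sections_ge rP) (clsE _ _ _ (@ge_interval_closed _ P a) rP).
Qed.

End Flabby.
(** * Hom objects out of constant modules *)

Section UnitHom.
Variable C : abCSMCat.
Implicit Types A B T Y : C.

Local Notation abC := (base_abelian C).
Local Notation tm := (tensm C).

Definition runit_inv A : hom A (tens C A (unit_ob C)) :=
  projT1 (cid (runit_iso C A)).

Lemma runit_invK A : runit_inv A \oc runit C A = idm _.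
Proof. exact: (projT2 (cid (runit_iso C A))).1. Qed.

Lemma runitK A : runit C A \oc runit_inv A = idm A.
Proof. exact: (projT2 (cid (runit_iso C A))).2. Qed.

Lemma runit_inv_nat A B (f : hom A B) :
  runit_inv B \oc f = tm f (idm _) \oc runit_inv A.
Proof.
rewrite -[RHS]comp1m -runit_invK -compA (compA (runit _ _)) runit_nat.
by rewrite -(compA f) runitK compm1.
Qed.

Definition unit_ev Y : hom (ihom C (unit_ob C) Y) Y :=
  ev C (unit_ob C) Y \oc runit_inv _.

Lemma unit_evE Y T (u : hom T (ihom C (unit_ob C) Y)) :
  unit_ev Y \oc u = ev C _ Y \oc tm u (idm _) \oc runit_inv T.
Proof. by rewrite /unit_ev -compA runit_inv_nat compA. Qed.

Lemma unit_ev_inj Y T (u v : hom T (ihom C (unit_ob C) Y)) :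
  unit_ev Y \oc u = unit_ev Y \oc v -> u = v.
Proof.
rewrite !unit_evE => /(congr1 (comp^~ (runit C T))).
by rewrite -!(compA _ (runit_inv T)) runit_invK !compm1; exact: ihom_eq.
Qed.

Lemma unit_ev_lift Y T (x : hom T Y) : exists u, unit_ev Y \oc u = x.
Proof.
exists (curry C (x \oc runit C T)).
by rewrite unit_evE curryK -compA runitK compm1.
Qed.

Lemma unit_ev_nat Y Y' (g : hom Y Y') :
  unit_ev Y' \oc ihomm (idm (unit_ob C)) g = g \oc unit_ev Y.
Proof. by rewrite unit_evE ihommE tensm_id compm1 -compA. Qed.

Lemma ihom_zero A Y T (u v : hom T (ihom C A Y)) : is_zero_object A -> u = v.
Proof.
move=> A0.
(* Tensoring a zero map on either side gives zero, by the braiding. Since the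
   identity of [A] is a zero map, this applies to [tm w (idm A)]. *)
have tm0 S (w : hom T S) : tm w (idm A) = 0.
  rewrite (zero_object_homl (idm A) 0 A0).
  rewrite -[tm _ _]comp1m -braid_sym -compA braid_nat.
  have -> : tm (0 : hom A A) w = tm 0 (idm S) \oc tm (idm A) w.
    by rewrite -tensm_comp comp0m comp1m.
  by rewrite tensm0 comp0m comp0m compm0.
by apply: ihom_eq; rewrite !tm0.
Qed.

Local Notation one := (const_ob abC (unit_ob C)).

(** Covering both values of [s] uniformly lets the end that defines a Hom
    object be read as a limit of the objects [Y] alone: [const_ev s Y] is an
    isomorphism onto [Y] or the zero map out of a zero object. *)
Definition const_ev (s : bool) Y : hom (ihom C (one s) Y) Y :=
  if s is true then unit_ev Y else 0.

Lemma const_ev_inj s Y T (u v : hom T (ihom C (one s) Y)) :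
  const_ev s Y \oc u = const_ev s Y \oc v -> u = v.
Proof.
case: s u v => u v /=; first exact: unit_ev_inj.
by move=> _; apply: ihom_zero; exact: zero_objectP.
Qed.

Lemma const_ev_lift s Y T (x : hom T Y) : (~~ s -> x = 0) ->
  exists u, const_ev s Y \oc u = x.
Proof.
case: s => /= x0; first exact: unit_ev_lift.
by exists 0; rewrite comp0m x0.
Qed.

Lemma const_ev_nat s Y Y' (g : hom Y Y') :
  const_ev s Y' \oc ihomm (idm (one s)) g = g \oc const_ev s Y.
Proof. by case: s => /=; [exact: unit_ev_nat | rewrite comp0m compm0]. Qed.

Lemma const_ev_map s t Y :
  const_ev s Y \oc ihomm (const_map abC (unit_ob C) s t) (idm Y) =
  if s then const_ev t Y else 0.
Proof.
case: s; last by rewrite comp0m.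
case: t => /=; first by rewrite ihomm_id compm1.
rewrite -[LHS]compm1 (_ : idm (ihom C (one false) Y) = 0) ?compm0 //.
by apply: ihom_zero; exact: zero_objectP.
Qed.

End UnitHom.

Section HomSections.
Variables (disp : Order.disp_t) (P : finPOrderType disp) (C : abCSMCat).
Variables (S : pred P) (convS : interval_closed S).
Implicit Types X Y J : pmodule P C.

Local Notation abC := (base_abelian C).

Definition indicator : pmodule P C := const_on abC (unit_ob C) convS.

Definition Hom_section X c : hom (Homob indicator X) (X c) :=
  const_ev (S c) (X c) \oc Hompr indicator X c.

Lemma Hom_section_nat X Y (s : pmhom X Y) c :
  Hom_section Y c \oc Hommap indicator s = s c \oc Hom_section X c.
Proof.
by rewrite -compA HommapE compA const_ev_nat -compA.
Qed.

(** A wedge from [T] over the internal homs out of [indicator] is the same as a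
    family of maps [T -> X c] over [S], and the wedge condition becomes the
    section condition. *)
Lemma Hom_represents_sections X : represents_sections S (Hom_section X).
Proof.
have [wedge univ] := HomP indicator X; split.
- split=> [c /negPf Sc|c d cd Sc].
    rewrite /Hom_section; move: (Hompr _ _ _); rewrite /= Sc => h.
    by rewrite comp0m.
  rewrite /Hom_section compA -const_ev_nat -compA wedge compA.
  by rewrite (const_ev_map (S c) (S d) (X d)) Sc.
- move=> T x [x0 xS].
  have [u uE] := choice_dep (fun c => const_ev_lift (x0 c)).
  have uw : is_wedge (M := indicator) u.
    move=> c d cd; apply: (const_ev_inj (s := S c)).
    rewrite compA const_ev_nat -compA uE [RHS]compA.
    rewrite (const_ev_map (S c) (S d) (X d)).
    have [Sc|nSc] := boolP (S c); first by rewrite uE xS.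
    by rewrite x0 // compm0 comp0m.
  have [v [vE _]] := univ T u uw.
  by exists v => c; rewrite -compA vE uE.
move=> T u v uv; apply: Hom_ext => c; apply: (const_ev_inj (s := S c)).
by rewrite !compA; exact: uv.
Qed.

Lemma Hommap_kernel X J Y (k : pmhom X J) (e : pmhom J Y) :
  (forall c, is_kernel (e c) (k c)) ->
  is_kernel (Hommap indicator e) (Hommap indicator k).
Proof.
move=> kk; have mk c := kernel_monic (kk c).
have [_ pXE pXU] := Hom_represents_sections X.
have [pJS _ pJU] := Hom_represents_sections J.
have [_ _ pYU] := Hom_represents_sections Y.
apply: is_kernelP => [T u v uv||T y ey0].
- apply: pXU => c; apply: mk.
  by rewrite [LHS]compA [RHS]compA -!Hom_section_nat -[LHS]compA uv compA.
- apply: pYU => c.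
  by rewrite compA Hom_section_nat -compA Hom_section_nat compA (kk c).1
    comp0m compm0.
have lift c : exists x, k c \oc x = Hom_section J c \oc y.
  apply: (kernel_lift (kk c)).
  by rewrite compA -Hom_section_nat -compA ey0 compm0.
have [x xE] := choice_dep lift.
have [|v vE] := pXE T x.
  split=> [c nSc|c d cd Sc].
    by apply: (monic0 (mk c)); rewrite xE pJS.1 // comp0m.
  by apply: mk; rewrite compA pmnat -compA !xE compA pJS.2.
by exists v; apply: pJU => c; rewrite compA Hom_section_nat -compA vE.
Qed.

End HomSections.

(** * Euler characteristics *)

Lemma injresP (C : preaddCat) (abC : abelian C) (enoughC : enough_injectives C)
    (X : C) : is_injective_resolution (injres X).
Proof.
rewrite /injres; case: pselect => [h|[]]; first exact: projT2 (cid h).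
exact: injective_resolution_exists.
Qed.

Lemma mobius_inversionD (disp : Order.disp_t) (P : finPOrderType disp)
    (V : zmodType) (m m1 m2 : P -> V) : (forall b, m b = m1 b + m2 b) ->
  forall a,
  mobius_inversion m a = mobius_inversion m1 a + mobius_inversion m2 a.
Proof.
move=> mE a; rewrite /mobius_inversion -big_split /=.
by apply: eq_bigr => b _; rewrite mE mulrzDl.
Qed.

Section EulerCharacteristic.
Variables (disp : Order.disp_t) (P : finPOrderType disp) (C : abCSMCat).
Variable enoughC : enough_injectives C.
Variables (S : pred P) (convS : interval_closed S).

Local Notation abC := (base_abelian C).
Local Notation PC := (pmodCat P C).

(** The telescoping argument: [D n] measures how far the Hom object into the
    [n]-th cosyzygy is from the value it would have if that module were
    flabby. The classes of the Ext objects up to degree [n] alternate to the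
    asserted value plus [D n] with a sign, and [D n] is zero once the cosyzygy
    is flabby. *)
Theorem chi_indicator (N : pmodule P C) :
  chi (indicator C convS) N =
  \sum_(b | S b) mobius_inversion (fun c => cls (N c)) b.
Proof.
have abP : abelian PC := pmod_abelian P abC.
have enP : enough_injectives PC := pmod_enough_injectives abC enoughC.
have resN := injresP abP enP N.
have [injJ _ _ _] := resN.
have [Z [k [e [Z0 kk ee dE]]]] := cosyzygies abP resN.
set J : nat -> PC := injres (N : PC) in injJ k e kk ee dE.
have kkc n c : is_kernel ((e n : pmhom _ _) c) ((k n : pmhom _ _) c).
  exact: (pmod_kernelP abC (e n) (k n)).1.
have eec n c : epic ((e n : pmhom _ _) c).
  exact: (pmod_epicP abC (e n)).1.
pose phi (X : pmodule P C) :=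
  \sum_(b | S b) mobius_inversion (fun c => cls (X c)) b.
pose G (X : pmodule P C) := cls (Homob (indicator C convS) X).
have flabbyG (X : pmodule P C) : (forall b, flabby_at X b) -> G X = phi X.
  move=> flX; apply: (cls_flabby_sections abC _ flX convS).
    move=> R convR.
    exists (Homob (indicator C convR) X), (Hom_section convR X).
    exact: Hom_represents_sections.
  exact: Hom_represents_sections.
have flJ n b : flabby_at (J n : pmodule P C) b := injective_flabby abC (injJ n).
have flZ n b : (#|[pred c | (b < c)%O]| < n)%N ->
    flabby_at (Z n : pmodule P C) b.
  elim: n b => // n IH b.
  exact: (flabby_cokernel abC (kkc n) (eec n) (flJ n) IH).
have phiJ n : phi (J n) = phi (Z n) + phi (Z n.+1).
  rewrite /phi -big_split /=; apply: eq_bigr => b _.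
  apply: mobius_inversionD => c.
  exact: (cls_kernel abC (kkc n c) (eec n c)).
pose D n := G (Z n) - phi (Z n).
have kerF n : is_kernel
    (fmap (HomFunctor (indicator C convS)) (codiff (injres (N : PC)) n))
    (Hommap (indicator C convS) (k n)).
  rewrite dE fmap_comp; apply/is_kernel_monic_comp.
    exact: kernel_monic (Hommap_kernel convS (kkc n.+1)).
  exact: Hommap_kernel (kkc n).
have Ext0 : cls (Ext 0 (indicator C convS) N) = G (Z 0).
  rewrite (cls_homology abC _ (kf := idm _) _ (kerF 0)) ?addrK //.
  apply: is_kernelP => [X u v|| X x _]; first by rewrite !comp1m.
    by rewrite comp0m.
  by exists x; rewrite comp1m.
have ExtS n : cls (Ext n.+1 (indicator C convS) N) = D n + D n.+1.
  rewrite (cls_homology abC _ (kerF n) (kerF n.+1)).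
  rewrite -/(G _) -[cls (HomFunctor _ _)]/(G (J n)) (flabbyG _ (flJ n)) phiJ.
  by rewrite /D addrACA opprD addrC [G (Z n) + _]addrC addrC.
have partial n :
    \sum_(d < n.+1) cls (Ext d (indicator C convS) N) *~ (-1) ^+ d =
    phi (Z 0) + D n *~ (-1) ^+ n.
  elim: n => [|n IH].
    by rewrite big_ord1 Ext0 !expr0 !mulr1z addrC subrK.
  rewrite big_ord_recr IH /= ExtS mulrzDl exprS mulN1r !mulrNz.
  by rewrite -addrA addNKr.
have D0 n : (#|P| < n)%N -> D n = 0.
  move=> Pn; rewrite /D flabbyG ?subrr // => b; apply: flZ.
  exact: leq_ltn_trans (max_card _) Pn.
(* The degrees [d.+1] with [#|P| < d] contribute [D d + D d.+1 = 0]. *)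
pose term d := cls (Ext d (indicator C convS) N) *~ (-1) ^+ d.
transitivity (\sum_(d < #|P|.+3) term d); last first.
  by rewrite partial D0 // mul0rz addr0 /phi Z0.
rewrite [RHS](fsbig_ord _ _ term).
apply: esym; apply: fsbig_widen => [|d [_ /= /negP]]; first exact: subsetT.
rewrite -leqNgt; 
case: d => // d Pd; have Pd1 : (#|P| < d)%N := ltnW Pd.
by rewrite /= /term ExtS D0 // D0 ?addr0 ?mul0rz //; exact: leqW.
Qed.

End EulerCharacteristic.

Lemma pmodule_irrelevance (disp : Order.disp_t) (P : porderType disp)
    (C : preaddCat) (M : P -> C)
    (h : forall a b, (a <= b)%O -> hom (M a) (M b)) h1 h1' h2 h2' :
  @PModule _ P C M h h1 h2 = @PModule _ P C M h h1' h2'.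
Proof. by rewrite (Prop_irrelevance h1 h1') (Prop_irrelevance h2 h2'). Qed.

Lemma fiber_interval_closed (dP dQ : Order.disp_t) (P : porderType dP)
    (Q : porderType dQ) (g : Q -> P) (a : P) :
  {homo g : x y / (x <= y)%O} -> interval_closed (fun x => g x == a).
Proof.
move=> gm x y z xy yz /eqP gx /eqP gz.
by rewrite eq_le -{1}gz gm //= -gx gm.
Qed.

Theorem theorem6p10 (dP dQ : Order.disp_t) (P : finPOrderType dP)
    (Q : finPOrderType dQ) (C : abCSMCat) (enoughC : enough_injectives C)
    (f : P -> Q) (g : Q -> P) (fg : galois_connection f g)
    (N : pmodule Q C) (a : P) :
  let n := fun x : Q => cls (N x) in
  let fN := pullback (galois_monol fg) N in
  let g1a := pullback (galois_monor fg) (skyscraper C a) in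
  [/\ mobius_inversion (fun_pullback f n) a = chi (skyscraper C a) fN,
      chi (skyscraper C a) fN = chi g1a N
    & chi g1a N = fun_pushforward g (mobius_inversion n) a].
Proof.
move=> n fN g1a.
have sky : skyscraper C a =
    indicator C (fiber_interval_closed (g := id) (a := a) (fun _ _ => id)).
  exact: pmodule_irrelevance.
have g1aE : g1a =
    indicator C (fiber_interval_closed (a := a) (galois_monor fg)).
  exact: pmodule_irrelevance.
have chiP : chi (skyscraper C a) fN = mobius_inversion (fun_pullback f n) a.
  by rewrite sky chi_indicator // big_pred1_eq.
have chiQ : chi g1a N = fun_pushforward g (mobius_inversion n) a.
  by rewrite g1aE chi_indicator.
by split; rewrite ?chiP ?chiQ // (mobius_inversion_galois fg).
Qed.
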